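(* Let $k\geq 3$ be an odd integer, and let $\eta$ and $\xi$ be two vectors in $\mathbb{R}^k\setminus\mathbb{Z}^k$. Then the one-dimensional Fourier transform of the measure $$\sigma=\sum_{m\in\mathbb{Z}^k}\frac{e^{2\pi i\langle m,\xi\rangle}}{|m+\eta|}\big(\delta_{|m+\eta|}-\delta_{-|m+\eta|}\big)$$ on $\mathbb{R}$ is the distribution $$\widehat{\sigma}=-i\,e^{-2\pi i\langle\eta,\xi\rangle}\sum_{m\in\mathbb{Z}^k}\frac{e^{-2\pi i\langle m,\eta\rangle}}{|m+\xi|^{k-2}}\Big[\sum_{j=0}^{(k-3)/2}\beta_{j,k}\,|m+\xi|^j\Big((-1)^j\,\delta^{(j)}_{|m+\xi|}-\delta^{(j)}_{-|m+\xi|}\Big)\Big],$$ where $$\beta_{j,k}=\frac{(-1)^j\,(k-j-3)!}{j!\,(k-2j-3)!!}\Big(\frac{1}{2\pi}\Big)^{(k-3)/2}\quad (0\leq j\leq (k-3)/2).$$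
   Context: Here $|\cdot|$ is the Euclidean norm, $\langle\cdot,\cdot\rangle$ between vectors is the standard inner product on $\mathbb{R}^k$, $\delta_x$ is the unit mass at $x$, and $\delta_x^{(j)}$ is its $j$-th distributional derivative, $\langle\delta_x^{(j)},\varphi\rangle=(-1)^j\varphi^{(j)}(x)$. Infinite sums of distributions supported on a locally finite set (one with no finite accumulation points) are understood via their action on compactly supported smooth test functions. The Fourier transform of a Schwartz function on $\mathbb{R}$ is $\widehat{\varphi}(t)=\int_{\mathbb{R}}\varphi(x)e^{-2\pi i t x}\,dx$, and the Fourier transform of a temperate distribution is defined by $\langle\widehat{\sigma},\varphi\rangle=\langle\sigma,\widehat{\varphi}\rangle$ (bilinear pairing, no conjugation). The double factorial is $n!!=n(n-2)(n-4)\cdots$ (ending in $1$ or $2$), with $0!!=1$. *)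

(* Defs.v *)
From mathcomp Require Import all_boot all_order all_algebra.
From mathcomp Require Import all_classical all_reals all_analysis.
From mathcomp Require Import complex.

Set Implicit Arguments.
Unset Strict Implicit.
Unset Printing Implicit Defensive.

Import Order.TTheory GRing.Theory Num.Theory.
Import numFieldNormedType.Exports.

Local Open Scope ring_scope.
Local Open Scope complex_scope.
Local Open Scope classical_set_scope.

(* R[i] carries no normed-module structure over R, so derivatives and
   integrals of complex-valued functions of a real variable are taken on real
   and imaginary parts. *)

Definition reF (R : realType) (f : R -> R[i]) : R -> R :=
  fun x => complex.Re (f x).
Definition imF (R : realType) (f : R -> R[i]) : R -> R :=
  fun x => complex.Im (f x).

Definition cderive (R : realType) (n : nat) (f : R -> R[i]) : R -> R[i] :=
  fun x => (reF f)^`(n) x +i* (imF f)^`(n) x.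

(* [derive1n] is a junk value off the differentiable functions, hence the
   explicit derivability at every order. *)
Definition csmooth (R : realType) (f : R -> R[i]) : Prop :=
  forall (n : nat) (x : R),
    derivable (reF f)^`(n) x 1 /\ derivable (imF f)^`(n) x 1.

Definition cintegral (R : realType) (f : R -> R[i]) : R[i] :=
  (\int[@lebesgue_measure R]_(x in setT) reF f x)%R
    +i* (\int[@lebesgue_measure R]_(x in setT) imF f x)%R.

Definition cis (R : realType) (t : R) : R[i] := cos t +i* sin t.

Definition fourier (R : realType) (f : R -> R[i]) : R -> R[i] :=
  fun t => cintegral (fun x => f x * cis (- (2 * pi * t * x))).

Definition test_function (R : realType) (f : R -> R[i]) : Prop :=
  csmooth f /\ exists M : R, forall x : R, M < `|x| -> f x = 0.

Definition schwartz_values (R : realType) (p n : nat) (f : R -> R[i]) : set R :=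
  [set `|x| ^+ p * Normc.normc (cderive n f x) | x in setT].

Definition schwartz (R : realType) (f : R -> R[i]) : Prop :=
  csmooth f /\ forall p n : nat, has_ubound (schwartz_values p n f).

Definition seminorm (R : realType) (p n : nat) (f : R -> R[i]) : R :=
  sup (schwartz_values p n f).

(* Functionals are total on R -> R[i]; only their values on the relevant
   function space (test or Schwartz functions) are meaningful. *)
Definition functional (R : realType) : Type := (R -> R[i]) -> R[i].

(* Continuous linear functionals on the Schwartz space, continuity being with
   respect to the seminorms sup |x^p f^(n)(x)|. *)
Definition temperate (R : realType) (T : functional R) : Prop :=
  (forall (a : R[i]) (f g : R -> R[i]), schwartz f -> schwartz g ->
     T (fun x => a * f x + g x) = a * T f + T g) /\
  exists (C : R) (N : nat), forall f : R -> R[i], schwartz f ->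
    Normc.normc (T f) <= C * \sum_(p < N.+1) \sum_(n < N.+1) seminorm p n f.

(* s and t are distributions, given by their action on test functions. The
   temperate distribution T extending s is unique, since test functions are
   dense in the Schwartz space; its Fourier transform is T \o fourier. *)
Definition has_fourier_transform (R : realType) (s t : functional R) : Prop :=
  exists T : functional R,
    [/\ temperate T,
        forall f : R -> R[i], test_function f -> T f = s f
      & forall f : R -> R[i], test_function f -> T (fourier f) = t f].

(* The j-th distributional derivative of the unit mass at x. *)
Definition delta (R : realType) (j : nat) (x : R) : functional R :=
  fun f => (-1) ^+ j * cderive j f x.

Fixpoint dfact (n : nat) : nat :=
  if n is n'.+2 then (n * dfact n')%N else 1%N.

(* The library norm on matrices is the sup norm, not the Euclidean one. *)
Definition dotv (R : realType) (k : nat) (u v : 'rV[R]_k) : R :=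
  \sum_(i < k) u 0 i * v 0 i.
Definition enorm (R : realType) (k : nat) (u : 'rV[R]_k) : R :=
  Num.sqrt (dotv u u).

Definition zvec (R : realType) (k : nat) (m : 'rV[int]_k) : 'rV[R]_k :=
  map_mx intr m.

Definition beta_coef (R : realType) (j k : nat) : R :=
  (-1) ^+ j * ((k - j - 3)`!)%:R / ((j`!)%:R * (dfact (k - 2 * j - 3))%:R)
    * (1 / (2 * pi)) ^+ ((k - 3)./2).

(* \sum_(m \in A) is the sum of a finitely supported family. The two sums below
   are finitely supported when f is a test function, the points +-|m + eta|
   and +-|m + xi| forming locally finite sets. *)

Definition sigma (R : realType) (k : nat) (eta xi : 'rV[R]_k) : functional R :=
  fun f => \sum_(m \in [set: 'rV[int]_k])
    let r := enorm (zvec R m + eta) in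
    cis (2 * pi * dotv (zvec R m) xi) / r%:C
      * (delta 0 r f - delta 0 (- r) f).

Definition sigma_hat (R : realType) (k : nat) (eta xi : 'rV[R]_k) :
    functional R :=
  fun f => - 'i%C * cis (- (2 * pi * dotv eta xi)) *
    \sum_(m \in [set: 'rV[int]_k])
      let r := enorm (zvec R m + xi) in
      cis (- (2 * pi * dotv (zvec R m) eta)) / (r ^+ (k - 2))%:C *
      \sum_(j < ((k - 3)./2).+1)
        (beta_coef R j k * r ^+ j)%:C *
        ((-1) ^+ j * delta j r f - delta j (- r) f).

(* Main.v *)
Require Import Defs.
From mathcomp Require Import all_boot all_order all_algebra.
From mathcomp Require Import all_classical all_reals all_analysis.
From mathcomp Require Import measurable_realfun complex ring lra zify.
Set Implicit Arguments.
Unset Strict Implicit.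
Unset Printing Implicit Defensive.
Import Order.TTheory GRing.Theory Num.Theory.
Import numFieldNormedType.Exports.
Local Open Scope ring_scope.
Local Open Scope complex_scope.
Local Open Scope classical_set_scope.

(** Pairing sigma with the Fourier transform of a test function f only sees the
    odd part of f.  With h(x) = f(x) - f(-x) and r = |m + eta|,

      fhat(r) - fhat(-r) = - i S(r),   S(r) = int h(x) sin(2 pi r x) dx,

    so the claim reads, for k = 2N + 3,

      sum_m e^(2 pi i <m,xi>) S(|m + eta|) / |m + eta|
        = e^(-2 pi i <eta,xi>) sum_m e^(-2 pi i <m,eta>) A_N h(|m + xi|),

    where A_N h = (- 1/(2 pi x) d/dx)^N (h(x)/x).  Expanding A_N h by the Leibniz
    rule produces the coefficients beta_(j,k) ([bessel_coefE],
    [bessel_coef_sum]).  Conceptually this is Poisson summation on R^k for the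
    radial function S(|y|)/|y|, whose k-dimensional Fourier transform is A_N h;
    the proof avoids Fourier analysis on R^k by testing only on Gaussians, the
    radial functions that are products of functions of the coordinates.

    An odd smooth h can be written x q_0(x) with q_0 a smooth function of x^2,
    and differentiating with respect to x^2 gives a sequence of smooth even
    functions with q_i' = 2 x q_(i+1), called a profile ([odd_profile]).  In these
    terms A_N h = (- 1/pi)^N q_N, and the whole identity is a statement about the
    profile, [summation_formula].

    - For q_0 = e^(-c x^2) both sides are explicit, and the identity is a product
      of k identities between one-dimensional theta series ([theta_lattice]).
      These are Poisson summation for a modulated Gaussian ([poisson_gaussian]),
      proved by integrating the Gaussian against the Fejer kernel: on the Fourier
      side this gives the Cesaro means of one series, and in x the kernel
      concentrates at the integers and gives the terms of the other.

    - Combinations of Gaussians e^(-c x^2), c = 2, 3, 4, ..., are dense among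
      compactly supported profiles.  In the variable v = e^(-x^2), ranging over
      (0, 1], they are polynomials, so Bernstein polynomials approximate q_K for
      any chosen K, and integrating back from infinity in the variable x^2
      approximates q_0, ..., q_K simultaneously, with errors at most
      eps e^(-2 x^2) ([gaussian_approx]).

    - Both sides are continuous for such errors ([summation_closure]).  The right
      hand side is clear.  On the left each integration by parts in S(r) gains a
      factor 1/r and consumes one index of the profile ([trig_decay]), so 2k
      indices give decay like (1 + r^2)^(-k), which is summable over the lattice
      because 1 + r^2 is at least 1 + (m_i + eta_i)^2 for every i.

    The temperate extension of sigma is the limit of the sums over the boxes
    [-n, n]^k.  Its continuity uses that eta is not a lattice point: the distances
    |m + eta| are then bounded below ([enorm_gap]). *)

(** * Calculus of functions differentiable on the whole line *)

Section Toolbox.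
Context {R : realType}.
Implicit Types (f g df dg : R -> R) (a b c r t x : R).

Definition has_deriv f df := forall x : R, is_derive x 1 f (df x).

Lemma has_deriv_eq f df dg : has_deriv f df -> df =1 dg -> has_deriv f dg.
Proof. by move=> h e x; have := h x; rewrite e. Qed.

Lemma has_derivD f df g dg : has_deriv f df -> has_deriv g dg ->
  has_deriv (fun x => f x + g x) (fun x => df x + dg x).
Proof. by move=> hf hg x; exact: is_deriveD. Qed.

Lemma has_derivB f df g dg : has_deriv f df -> has_deriv g dg ->
  has_deriv (fun x => f x - g x) (fun x => df x - dg x).
Proof. by move=> hf hg x; exact: is_deriveB. Qed.

Lemma has_derivM f df g dg : has_deriv f df -> has_deriv g dg ->
  has_deriv (fun x => f x * g x) (fun x => df x * g x + f x * dg x).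
Proof.
move=> hf hg x; apply: (is_derive_eq (is_deriveM (hf x) (hg x))).
by rewrite addrC /GRing.scale /= mulrC.
Qed.

Lemma has_deriv_cst c : has_deriv (fun=> c) (fun=> 0).
Proof. by move=> x; exact: is_derive_cst. Qed.

Lemma has_deriv_id : has_deriv (fun x => x) (fun=> 1).
Proof. by move=> x; exact: is_derive_id. Qed.

Lemma has_derivZ c f df : has_deriv f df ->
  has_deriv (fun x => c * f x) (fun x => c * df x).
Proof. by move=> hf x; exact: (@is_deriveZ _ _ _ f c x 1 _ (hf x)). Qed.

Lemma has_derivN f df : has_deriv f df -> has_deriv (fun x => - f x) (fun x => - df x).
Proof. by move=> hf x; exact: is_deriveN. Qed.

Lemma has_deriv_comp f df g dg : has_deriv f df -> has_deriv g dg ->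
  has_deriv (fun x => f (g x)) (fun x => dg x * df (g x)).
Proof.
move=> hf hg x; apply: (is_derive_eq (is_derive1_comp (hf (g x)) (hg x))).
by rewrite /GRing.scale /= mulrC.
Qed.

Lemma has_deriv_sin : has_deriv (@sin R) (@cos R).
Proof. by move=> x; exact: is_derive_sin. Qed.

Lemma has_deriv_cos : has_deriv (@cos R) (fun x => - sin x).
Proof. by move=> x; exact: is_derive_cos. Qed.

Lemma has_deriv_expR : has_deriv (@expR R) (@expR R).
Proof. by move=> x; exact: is_derive_expR. Qed.

Lemma has_derivX n : has_deriv (fun x => x ^+ n) (fun x => n%:R * x ^+ n.-1).
Proof.
elim: n => [|n IH].
  by apply: (has_deriv_eq (has_deriv_cst 1)) => x; rewrite mul0r.
have := has_derivM has_deriv_id IH.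
rewrite (_ : (fun x => x * x ^+ n) = (fun x => x ^+ n.+1)); last first.
  by apply/funext => x; rewrite exprS.
move=> h; apply: (has_deriv_eq h) => x /=.
case: n {IH h} => [|n] /=; first by rewrite !expr0; ring.
by rewrite !exprS -[in RHS]natr1; ring.
Qed.

Lemma has_deriv_cosl a b :
  has_deriv (fun x => cos (a * x + b)) (fun x => - (a * sin (a * x + b))).
Proof.
have h := has_deriv_comp has_deriv_cos
  (has_derivD (has_derivZ a has_deriv_id) (has_deriv_cst b)).
by apply: (has_deriv_eq h) => x /=; ring.
Qed.

Lemma has_deriv_sinl a b :
  has_deriv (fun x => sin (a * x + b)) (fun x => a * cos (a * x + b)).
Proof.
have h := has_deriv_comp has_deriv_sin
  (has_derivD (has_derivZ a has_deriv_id) (has_deriv_cst b)).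
by apply: (has_deriv_eq h) => x /=; ring.
Qed.

Lemma has_deriv_continuous f df : has_deriv f df -> continuous f.
Proof.
move=> h x; apply/differentiable_continuous/derivable1_diffP.
by have [] := h x.
Qed.

Lemma has_deriv_ndecr f df a b : has_deriv f df ->
  (forall x, a < x < b -> 0 <= df x) -> a <= b -> f a <= f b.
Proof.
move=> h pos ab.
have cf := has_deriv_continuous h.
apply: (@ger0_derive1_le_cc _ f a b) => //.
- by move=> x _; have [] := h x.
- move=> x xab; rewrite derive1E; have [_ ->] := h x; apply: pos.
  by move: xab; rewrite in_itv.
- exact: continuous_subspaceT.
- by rewrite in_itv /= lexx.
- by rewrite in_itv /= lexx andbT.
Qed.

(** Comparing f with C x by monotonicity gives the mean value inequality without
    a choice of intermediate point. *)
Lemma has_deriv_lip f df a b C : has_deriv f df ->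
  (forall x, a < x < b -> `|df x| <= C) -> a <= b -> `|f b - f a| <= C * (b - a).
Proof.
move=> h bd ab.
have h1 := has_derivB (has_derivZ C has_deriv_id) h.
have h2 := has_derivD (has_derivZ C has_deriv_id) h.
have := has_deriv_ndecr h1; move=> /(_ a b) -/(_ _ ab) H1.
have := has_deriv_ndecr h2; move=> /(_ a b) -/(_ _ ab) H2.
have {}H1 : C * a - f a <= C * b - f b.
  by apply: H1 => x /bd; rewrite ler_norml => /andP[_ ?]; lra.
have {}H2 : C * a + f a <= C * b + f b.
  by apply: H2 => x /bd; rewrite ler_norml => /andP[? _]; lra.
rewrite ler_norml; apply/andP; split; nra.
Qed.

Lemma has_deriv0_cst f : has_deriv f (fun=> 0) -> forall x y, f x = f y.
Proof.
move=> h x y; wlog xy : x y / x <= y.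
  by move=> H; have [/H//|/ltW /H//] := leP x y.
have := @has_deriv_lip f _ x y 0 h; rewrite mul0r => H.
apply/esym/eqP; rewrite -subr_eq0 -normr_le0; apply: H => //.
by move=> *; rewrite normr0.
Qed.

(** * Integrals of functions dominated by a Gaussian *)

Local Notation mu := (@lebesgue_measure R).

Definition integ f : R := \int[mu]_(x in setT) f x.

(** Every integrand below lies in this class; it is stable under the operations
    used, which settles integrability and the vanishing of boundary terms once and
    for all. *)
Definition gauss_dominated f := continuous f /\ exists C : R, forall x, `|f x| <= C * gauss_fun x.

Lemma gauss_fun_gt0 x : 0 < gauss_fun x :> R. Proof. exact: expR_gt0. Qed.

Lemma gdom_int f : gauss_dominated f -> mu.-integrable setT (EFin \o f).
Proof.
move=> [cf [C hC]].
apply: (le_integrable measurableT) (integrableZl measurableT C (@integrableT_gauss R)).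
  by apply/measurable_EFinP; exact: continuous_measurable_fun.
move=> x _ /=; rewrite lee_fin; apply: (le_trans (hC x)); exact: ler_norm.
Qed.

Lemma integ_gauss : integ gauss_fun = Num.sqrt pi.
Proof. by rewrite /integ /Rintegral integralT_gauss. Qed.

Lemma continuous_add f g : continuous f -> continuous g -> continuous (fun x => f x + g x).
Proof. by move=> hf hg x; apply: cvgD; [exact: hf|exact: hg]. Qed.
Lemma continuous_sub f g : continuous f -> continuous g -> continuous (fun x => f x - g x).
Proof. by move=> hf hg x; apply: cvgB; [exact: hf|exact: hg]. Qed.
Lemma continuous_mul f g : continuous f -> continuous g -> continuous (fun x => f x * g x).
Proof. by move=> hf hg x; apply: cvgM; [exact: hf|exact: hg]. Qed.

Lemma gdomD f g : gauss_dominated f -> gauss_dominated g -> gauss_dominated (fun x => f x + g x).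
Proof.
move=> [cf [C hC]] [cg [D hD]]; split; first exact: continuous_add.
exists (C + D) => x; rewrite mulrDl; apply: (le_trans (ler_normD _ _)).
exact: lerD.
Qed.

Lemma gdomMb f g B : gauss_dominated f -> continuous g -> (forall x, `|g x| <= B) ->
  gauss_dominated (fun x => f x * g x).
Proof.
move=> [cf [C hC]] cg hB; split; first exact: continuous_mul.
exists (C * B) => x; rewrite normrM.
by apply: (le_trans (ler_pM _ _ (hC x) (hB x))) => //; rewrite mulrAC.
Qed.

Lemma gdomZ c f : gauss_dominated f -> gauss_dominated (fun x => c * f x).
Proof.
move=> h; rewrite (_ : (fun x => _) = (fun x => f x * c)); last first.
  by apply/funext => x; rewrite mulrC.
by apply: (@gdomMb _ _ `|c|) => // x; exact: cvg_cst.
Qed.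

Lemma gdomN f : gauss_dominated f -> gauss_dominated (fun x => - f x).
Proof.
by move=> /(gdomZ (-1)); under eq_fun do rewrite mulN1r.
Qed.

Lemma gdomB f g : gauss_dominated f -> gauss_dominated g -> gauss_dominated (fun x => f x - g x).
Proof. by move=> hf /gdomN; exact: gdomD. Qed.

Lemma gdom_gauss : gauss_dominated gauss_fun.
Proof.
split; first exact: continuous_gauss_fun.
by exists 1 => x; rewrite mul1r ger0_norm ?gauss_fun_ge0.
Qed.

Lemma gdom0 : gauss_dominated (fun=> 0).
Proof. by have := gdomZ 0 gdom_gauss; under eq_fun do rewrite mul0r. Qed.

Lemma gdom_sum (I : Type) (s : seq I) (F : I -> R -> R) : (forall i, gauss_dominated (F i)) ->
  gauss_dominated (fun x => \sum_(i <- s) F i x).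
Proof.
move=> h; elim: s => [|i s IH].
  by under eq_fun do rewrite big_nil; exact: gdom0.
by under eq_fun do rewrite big_cons; exact: gdomD.
Qed.

Lemma integD f g : gauss_dominated f -> gauss_dominated g -> integ (fun x => f x + g x) = integ f + integ g.
Proof. by move=> hf hg; apply: RintegralD => //; exact: gdom_int. Qed.

Lemma integB f g : gauss_dominated f -> gauss_dominated g -> integ (fun x => f x - g x) = integ f - integ g.
Proof. by move=> hf hg; apply: RintegralB => //; exact: gdom_int. Qed.

Lemma integZ c f : gauss_dominated f -> integ (fun x => c * f x) = c * integ f.
Proof. by move=> hf; apply: RintegralZl => //; exact: gdom_int. Qed.

Lemma integN f : gauss_dominated f -> integ (fun x => - f x) = - integ f.
Proof.
by move=> hf; rewrite -mulN1r -integZ//; under [in RHS]eq_fun do rewrite mulN1r.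
Qed.

Lemma integ_sum (I : Type) (s : seq I) (F : I -> R -> R) : (forall i, gauss_dominated (F i)) ->
  integ (fun x => \sum_(i <- s) F i x) = \sum_(i <- s) integ (F i).
Proof.
move=> h; elim: s => [|i s IH].
  under eq_fun do rewrite big_nil.
  by rewrite big_nil /integ Rintegral_cst// mul0r.
under eq_fun do rewrite big_cons.
by rewrite big_cons integD ?IH//; exact: gdom_sum.
Qed.

Lemma integ_le f g : gauss_dominated f -> gauss_dominated g -> (forall x, f x <= g x) -> integ f <= integ g.
Proof. by move=> hf hg h; apply: le_Rintegral => //; exact: gdom_int. Qed.

Lemma integ_bound f C : continuous f -> (forall x, `|f x| <= C * gauss_fun x) ->
  `|integ f| <= C * Num.sqrt pi.
Proof.
move=> cf h; have gf : gauss_dominated f by split=> //; exists C.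
rewrite -integ_gauss -integZ; last exact: gdom_gauss.
have gC : gauss_dominated (fun x => C * gauss_fun x) by apply: gdomZ; exact: gdom_gauss.
rewrite ler_norml -integN//; apply/andP; split; apply: integ_le => //; try exact: gdomN.
  by move=> x; have := h x; rewrite ler_norml => /andP[].
by move=> x; have := h x; rewrite ler_norml => /andP[].
Qed.

(** The half integers in the bounds make these intervals unions of unit intervals
    centred at the points a + m, as needed for Poisson summation. *)
Lemma integ_cvg f a : gauss_dominated f ->
  (\int[mu]_(x in `[a - n%:R - 2^-1, a + n%:R + 2^-1]) f x) @[n --> \oo] --> integ f.
Proof.
move=> gf.
pose D n : set R := `[a - n%:R - 2^-1, a + n%:R + 2^-1]%classic.
pose F (n : nat) : R -> \bar R := EFin \o (f \_ (D n)).
have mF n : measurable_fun setT (F n).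
  apply/measurable_EFinP; apply/(measurable_restrict _ _ _) => //=; rewrite ?setTI.
    exact: measurable_itv.
  by apply: measurable_funTS; apply: continuous_measurable_fun; case: gf.
have mf : measurable_fun setT (EFin \o f).
  by apply/measurable_EFinP; apply: continuous_measurable_fun; case: gf.
have ig : mu.-integrable setT (fun x => `|(EFin \o f) x|%E).
  exact/integrable_abse/gdom_int.
have cv : forall x : R, F n x @[n --> \oo] --> (EFin \o f) x.
  move=> x; apply: cvg_near_cst; near=> n.
  rewrite /F /= patchE ifT// inE /D /= in_itv /=.
  have : `|x - a| < n%:R by near: n; exact: nbhs_infty_gtr.
  by rewrite ltr_norml => /andP[? ?]; apply/andP; split; lra.
have [] := @dominated_convergence _ _ _ mu _ measurableT F _ _ mF mf _ ig.
- by apply: aeW => x _; exact: cv.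
- apply: aeW => x n _; rewrite /F /= lee_fin patchE.
  by case: ifP => // _; rewrite normr0.
move=> _ _ H; apply: fine_cvg => /=.
move: H; rewrite /= /integ /Rintegral fineK; last exact: (integrable_fin_num measurableT (gdom_int gf)).
apply: cvg_trans; apply: near_eq_cvg; near=> n.
by rewrite /F /D [in RHS]integral_mkcond restrict_EFin.
Unshelve. all: by end_near.
Qed.

End Toolbox.

Section Line.
Context {R : realType}.
Implicit Types (f g df dg F G : R -> R) (a b c r t x : R).
Local Notation mu := (@lebesgue_measure R).

Lemma integ_itv F f a b : has_deriv F f -> continuous f -> a <= b ->
  \int[mu]_(x in `[a, b]) f x = F b - F a.
Proof.
move=> h cf; rewrite le_eqVlt => /predU1P[->|ab].
  by rewrite subrr set_itv1 Rintegral_set1.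
have cF := has_deriv_continuous h.
rewrite /Rintegral (@continuous_FTC2 _ f F a b ab) //.
- exact: continuous_subspaceT.
- split=> //.
  + by move=> x _; have [] := h x.
  + exact/cvg_at_right_filter/cF.
  + exact/cvg_at_left_filter/cF.
- by move=> x _; rewrite derive1E; have [_ ->] := h x.
Qed.

Lemma gauss_fun_le_inv x : gauss_fun x <= (1 + x ^+ 2)^-1 :> R.
Proof.
rewrite /gauss_fun expRN lef_pV2 ?posrE ?expR_gt0//; first exact: expR_ge1Dx.
by rewrite ltr_wpDr// sqr_ge0.
Qed.

Lemma gauss_fun_harmonic n x : n%:R <= `|x| -> gauss_fun x <= 2 * n.+1%:R^-1 :> R.
Proof.
move=> nx; apply: (le_trans (gauss_fun_le_inv x)).
rewrite -[X in X * _]invrK -invfM lef_pV2 ?posrE.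
- have : 0 <= (`|x| - 1) ^+ 2 by exact: sqr_ge0.
  rewrite -(real_normK (num_real x)) -natr1; set y := `|x| in nx *; set m := n%:R in nx *.
  by rewrite sqrrB1 => H; rewrite ler_pdivrMl//; have := sqr_ge0 y; lra.
- by rewrite ltr_wpDr// sqr_ge0.
- by rewrite mulr_gt0// ?invr_gt0.
Qed.

Lemma gdom_cvg0 f (u : nat -> R) : gauss_dominated f -> (forall n, n%:R <= `|u n|) ->
  f (u n) @[n --> \oo] --> 0.
Proof.
move=> [_ [C hC]] hu; apply: norm_cvg0.
apply: (@squeeze_cvgr _ _ _ _ (fun=> 0) (fun n => (C * 2) * n.+1%:R^-1)).
- apply: nearW => n; rewrite normr_ge0 /=; apply: (le_trans (hC _)).
  have C0 : 0 <= C.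
    have := hC 0; rewrite -(pmulr_lge0 _ (gauss_fun_gt0 (0:R))).
    exact: le_trans.
  by rewrite -mulrA ler_wpM2l// gauss_fun_harmonic.
- exact: cvg_cst.
- by rewrite -(mulr0 (C * 2)); apply: cvgM; [exact: cvg_cst|exact: cvg_harmonic].
Qed.

(** This is integration by parts on the line: the boundary terms vanish. *)
Lemma integ_deriv0 f df : has_deriv f df -> gauss_dominated f -> gauss_dominated df -> integ df = 0.
Proof.
move=> h gf gdf.
have H := integ_cvg 0 gdf.
have h2 : 0 < 2^-1 :> R by rewrite invr_gt0.
have e : forall n, \int[mu]_(x in `[(0 - n%:R - 2^-1), (0 + n%:R + 2^-1)]) df x
   = f (n%:R + 2^-1) - f (- (n%:R + 2^-1)).
  move=> n; rewrite (integ_itv h); last 2 first.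
  - by case: gdf.
  - have : 0 <= n%:R :> R by []. lra.
  by rewrite add0r sub0r opprD.
move: H; under eq_cvg do rewrite e.
have H2 : (f (n%:R + 2^-1) - f (- (n%:R + 2^-1))) @[n --> \oo] --> (0 - 0 : R).
  by apply: cvgB; apply: (gdom_cvg0 gf) => n; have := ler0n R n; rewrite ?normrN => ?; rewrite ger0_norm; lra.
by move=> H1; rewrite (cvg_unique _ H1 H2) // subrr.
Qed.

Lemma integ_opp f : gauss_dominated f -> integ (fun x => f (- x)) = integ f.
Proof.
move=> gf.
have gf' : gauss_dominated (fun x => f (- x)).
  case: gf => cf [C hC]; split.
    by move=> x; apply: continuous_comp; [exact: continuousN|exact: cf].
  by exists C => x; apply: (le_trans (hC _)); rewrite /gauss_fun sqrrN.
have := integ_cvg 0 gf'; have := integ_cvg 0 gf => H1 H2.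
apply: cvg_unique H2 _ => //; apply: cvg_trans H1.
apply: near_eq_cvg; apply: nearW => n.
have h2 : 0 < 2^-1 :> R by rewrite invr_gt0.
have n0 : 0 <= n%:R :> R by [].
have ab : - (n%:R + 2^-1) <= n%:R + 2^-1 :> R by lra.
have cf : {within `[- (n%:R + 2^-1), - (- (n%:R + 2^-1))], continuous f}.
  by apply: continuous_subspaceT; case: gf.
have := integration_by_substitution_oppr ab cf.
by rewrite /Rintegral !add0r opprK -!opprD => ->.
Qed.

(** A majorant valid for all values of the parameter makes the local conditions of
    the general theorem trivial. *)
Lemma has_deriv_integral (B : set R) (f df : R -> R -> R) G : measurable B ->
  (forall t, mu.-integrable B (EFin \o f t)) ->
  (forall x, B x -> has_deriv (f^~ x) (df^~ x)) ->
  (forall x, 0 <= G x) -> mu.-integrable B (EFin \o G) ->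
  (forall t x, B x -> `|df t x| <= G x) ->
  has_deriv (fun t => \int[mu]_(x in B) f t x) (fun t => \int[mu]_(x in B) df t x).
Proof.
move=> mB intf hd G0 iG ub t.
have It : `]t - 1, t + 1[%classic t by rewrite /= in_itv /=; apply/andP; split; lra.
have d1 : forall s x, B x -> partial1of2 f s x = df s x.
  by move=> s x /hd /(_ s) [_]; rewrite partial1of2E => ->.
have H1 : forall s x, `]t - 1, t + 1[%classic s -> B x -> derivable (f^~ x) s 1.
  by move=> s x _ /hd /(_ s) [].
have H2 : forall s x, `]t - 1, t + 1[%classic s -> B x -> `|partial1of2 f s x| <= G x.
  by move=> s x _ Bx; rewrite d1//; exact: ub.
have H3 := @derivable_under_integral R _ _ mu f B mB t _ _ It (fun x _ => intf x) H1 G G0 iG H2.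
have H4 := @differentiation_under_integral R _ _ mu f B mB t _ _ It (fun x _ => intf x) H1 G G0 iG H2.
apply: DeriveDef => //; rewrite -derive1E H4.
by apply: eq_Rintegral => x /set_mem Bx; rewrite d1.
Qed.

(** * The Fourier transform of a Gaussian *)

Definition gaussian c x : R := expR (- c * x ^+ 2).

Lemma gaussian_gt0 c x : 0 < gaussian c x. Proof. exact: expR_gt0. Qed.

Lemma gaussian1 x : gaussian 1 x = gauss_fun x.
Proof. by rewrite /gaussian /gauss_fun mulN1r. Qed.

Lemma gaussian_le c d x : c <= d -> gaussian d x <= gaussian c x.
Proof. by move=> cd; rewrite /gaussian ler_expR ler_wpM2r ?sqr_ge0// lerN2. Qed.

Lemma has_deriv_gaussian c : has_deriv (gaussian c) (fun x => - (2 * c * x) * gaussian c x).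
Proof.
have h := has_deriv_comp has_deriv_expR (has_derivZ (- c) (has_derivX 2)).
by apply: (has_deriv_eq h) => x /=; rewrite expr1 /gaussian; ring.
Qed.

Lemma norm_power_bound n x : `|x| ^+ n <= (1 + n`!%:R) * expR (x ^+ 2).
Proof.
have e1 : 1 <= expR (x ^+ 2) by rewrite -expR0 ler_expR sqr_ge0.
have e2 : (x ^+ 2) ^+ n <= n`!%:R * expR (x ^+ 2).
  case: n => [|n]; first by rewrite expr0 fact0 mul1r.
  have := expR_ge1Dxn n (sqr_ge0 x) => H.
  rewrite mulrC -ler_pdivrMr ?ltr0n ?fact_gt0//.
  by apply: le_trans H; rewrite lerDr.
rewrite mulrDl mul1r; have [x1|x1] := leP `|x| 1.
  apply: (@le_trans _ _ 1); first by rewrite exprn_ile1.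
  by apply: (le_trans e1); rewrite lerDl mulr_ge0// expR_ge0.
apply: (@le_trans _ _ ((x ^+ 2) ^+ n)); last by rewrite (le_trans e2)// lerDr expR_ge0.
rewrite -(real_normK (num_real x)) -exprM mulnC exprM.
rewrite expr2; set y := `|x| ^+ n.
have : 1 <= y by rewrite exprn_ege1// ltW.
by move=> ?; nra.
Qed.

(** The weight e^(-2 x^2) leaves room for polynomial factors: their product with it
    is still dominated by e^(-x^2). *)
Lemma gaussian2_bound n x : `|x| ^+ n * gaussian 2 x <= (1 + n`!%:R) * gauss_fun x.
Proof.
rewrite -gaussian1 (_ : gaussian 1 x = expR (x ^+ 2) * gaussian 2 x); last first.
  by rewrite /gaussian -expRD; congr expR; lra.
by rewrite mulrA ler_wpM2r ?expR_ge0// norm_power_bound.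
Qed.

Lemma continuousX n : continuous (fun x : R => x ^+ n).
Proof. exact: has_deriv_continuous (@has_derivX _ n). Qed.

Lemma gdom_Xmul n f A : continuous f -> (forall x, `|f x| <= A * gaussian 2 x) ->
  gauss_dominated (fun x => x ^+ n * f x).
Proof.
move=> cf hA; split; first by apply: continuous_mul => //; exact: continuousX.
exists (A * (1 + n`!%:R)) => x.
have A0 : 0 <= A.
  have := hA 0; rewrite -(pmulr_lge0 _ (gaussian_gt0 2 (0:R))); exact: le_trans.
rewrite normrM normrX -mulrA.
apply: (@le_trans _ _ (A * (`|x| ^+ n * gaussian 2 x))).
  by rewrite mulrCA ler_wpM2l// exprn_ge0.
by rewrite ler_wpM2l// gaussian2_bound.
Qed.

Lemma continuous_gaussian c : continuous (gaussian c).
Proof. exact: has_deriv_continuous (@has_deriv_gaussian c). Qed.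

Lemma gdom_Xgaussian n c : 2 <= c -> gauss_dominated (fun x => x ^+ n * gaussian c x).
Proof.
move=> c2; apply: (@gdom_Xmul _ _ 1); first exact: continuous_gaussian.
by move=> x; rewrite mul1r gtr0_norm ?gaussian_gt0// gaussian_le.
Qed.

Lemma gdom_gaussian c : 2 <= c -> gauss_dominated (gaussian c).
Proof. by move=> /(gdom_Xgaussian 0); under eq_fun do rewrite expr0 mul1r. Qed.

Lemma continuous_cosl a b : continuous (fun x : R => cos (a * x + b)).
Proof. exact: has_deriv_continuous (@has_deriv_cosl _ a b). Qed.

Lemma continuous_sinl a b : continuous (fun x : R => sin (a * x + b)).
Proof. exact: has_deriv_continuous (@has_deriv_sinl _ a b). Qed.


Lemma gdom_cosl f a b : gauss_dominated f -> gauss_dominated (fun x => f x * cos (a * x + b)).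
Proof.
move=> gf; apply: (@gdomMb _ _ _ 1) => //; first exact: continuous_cosl.
by move=> x; exact: cos_max.
Qed.

Lemma gdom_sinl f a b : gauss_dominated f -> gauss_dominated (fun x => f x * sin (a * x + b)).
Proof.
move=> gf; apply: (@gdomMb _ _ _ 1) => //; first exact: continuous_sinl.
by move=> x; exact: sin_max.
Qed.

Definition cosine_transform f t := integ (fun x => f x * cos (t * x)).
Definition sine_transform f t := integ (fun x => f x * sin (t * x)).

Lemma gdom_cos f t : gauss_dominated f -> gauss_dominated (fun x => f x * cos (t * x)).
Proof. by move=> /(gdom_cosl t 0); under eq_fun do rewrite addr0. Qed.

Lemma gdom_sin f t : gauss_dominated f -> gauss_dominated (fun x => f x * sin (t * x)).
Proof. by move=> /(gdom_sinl t 0); under eq_fun do rewrite addr0. Qed.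

Lemma has_deriv_cosm t : has_deriv (fun x => cos (t * x)) (fun x => - (t * sin (t * x))).
Proof.
have := @has_deriv_cosl R t 0; under eq_fun do rewrite addr0.
by under [X in has_deriv _ X]eq_fun do rewrite addr0.
Qed.

Lemma has_deriv_sinm t : has_deriv (fun x => sin (t * x)) (fun x => t * cos (t * x)).
Proof.
have := @has_deriv_sinl R t 0; under eq_fun do rewrite addr0.
by under [X in has_deriv _ X]eq_fun do rewrite addr0.
Qed.

Lemma sine_ibp f df t : has_deriv f df -> gauss_dominated f -> gauss_dominated df ->
  sine_transform df t = - (t * cosine_transform f t).
Proof.
move=> h gf gdf.
have := integ_deriv0 (has_derivM h (has_deriv_sinm t)).
rewrite (_ : (fun x => df x * sin (t * x) + f x * (t * cos (t * x))) =
  (fun x => df x * sin (t * x) + t * (f x * cos (t * x)))); last first.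
  by apply/funext => x; ring.
have g1 := gdom_sin t gdf; have g2 := gdomZ t (gdom_cos t gf).
move=> /(_ (gdom_sin t gf) (gdomD g1 g2)).
rewrite integD// integZ; last exact: gdom_cos.
by rewrite -/(sine_transform _ _) -/(cosine_transform _ _) => H; lra.
Qed.

Lemma cosine_ibp f df t : has_deriv f df -> gauss_dominated f -> gauss_dominated df ->
  cosine_transform df t = t * sine_transform f t.
Proof.
move=> h gf gdf.
have := integ_deriv0 (has_derivM h (has_deriv_cosm t)).
rewrite (_ : (fun x => df x * cos (t * x) + f x * - (t * sin (t * x))) =
  (fun x => df x * cos (t * x) - t * (f x * sin (t * x)))); last first.
  by apply/funext => x; ring.
have g1 := gdom_cos t gdf; have g2 := gdomZ t (gdom_sin t gf).
move=> /(_ (gdom_cos t gf) (gdomB g1 g2)).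
rewrite integB// integZ; last exact: gdom_sin.
by rewrite -/(sine_transform _ _) -/(cosine_transform _ _) => H; lra.
Qed.

Lemma integ_gaussian c : 0 < c -> integ (gaussian c) = Num.sqrt (pi / c).
Proof.
move=> c0; pose s := Num.sqrt ((2 * c)^-1).
have c2 : 0 < 2 * c by rewrite mulr_gt0.
have s0 : s != 0 by rewrite gt_eqF// sqrtr_gt0 invr_gt0.
have s2 : s ^+ 2 = (2 * c)^-1 by rewrite sqr_sqrtr// invr_ge0 ltW.
have k0 := normal_peak_gt0 s0.
have e : gaussian c = fun x => (normal_peak s)^-1 * normal_pdf 0 s x.
  apply/funext => x; rewrite normal_pdfE// mulKf ?gt_eqF//.
  rewrite /gaussian /normal_fun s2 subr0; congr expR.
  by rewrite mulrC mulrN mulNr; congr (- (_ * _)); field; rewrite gt_eqF.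
rewrite e /integ RintegralZl//; last exact: integrable_normal_pdf.
rewrite /Rintegral integral_normal_pdf /= mulr1 invrK s2.
by congr Num.sqrt; field; rewrite gt_eqF.
Qed.

Lemma sine_Xgaussian c t : 2 <= c ->
  sine_transform (fun x => x * gaussian c x) t = t / (2 * c) * cosine_transform (gaussian c) t.
Proof.
move=> c2.
have c0 : c != 0 by rewrite gt_eqF//; lra.
have g1 := gdom_Xgaussian 1 c2.
have g2 : gauss_dominated (fun x => - (2 * c * x) * gaussian c x).
  rewrite (_ : (fun x => _) = (fun x => (- (2 * c)) * (x ^+ 1 * gaussian c x))).
    exact: gdomZ.
  by apply/funext => x; rewrite expr1; ring.
have := sine_ibp t (@has_deriv_gaussian c) (gdom_gaussian c2) g2.
rewrite (_ : sine_transform (fun x => - (2 * c * x) * gaussian c x) t =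
  (- (2 * c)) * sine_transform (fun x => x * gaussian c x) t).
  move=> H; apply: (mulfI (_ : 2 * c != 0)); first by rewrite mulf_neq0.
  move: H; rewrite mulNr => /oppr_inj ->.
  by field.
rewrite /sine_transform -integZ; last first.
  apply: gdom_sin; rewrite (_ : (fun x => _) = (fun x => x ^+ 1 * gaussian c x))//.
by congr integ; apply/funext => x; ring.
Qed.

(** Differentiating under the integral sign and then integrating by parts turns the
    derivative into a multiple of the transform itself. *)
Lemma has_deriv_cosine_gaussian c : 2 <= c ->
  has_deriv (cosine_transform (gaussian c)) (fun t => - (t / (2 * c)) * cosine_transform (gaussian c) t).
Proof.
move=> c2.
have g1 : gauss_dominated (fun x => x * gaussian c x) by exact: (gdom_Xgaussian 1 c2).
have h : has_deriv (cosine_transform (gaussian c)) (fun t => integ (fun x => - (x * gaussian c x) * sin (t * x))).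
  have [ca [C hC]] := g1.
  apply: (@has_deriv_integral setT (fun t x => gaussian c x * cos (t * x))
    (fun t x => - (x * gaussian c x) * sin (t * x)) (fun x => C * gauss_fun x)) => //.
  - by move=> t; exact/gdom_int/gdom_cos/gdom_gaussian.
  - move=> x _ t.
    have := has_derivZ (gaussian c x) (@has_deriv_cosm x) t.
    have -> : (fun s => gaussian c x * cos (x * s)) = (fun s => gaussian c x * cos (s * x)).
      by apply/funext => s; rewrite (mulrC x).
    by move=> H; apply: (is_derive_eq H); rewrite (mulrC x t); ring.
  - by move=> x; apply: le_trans (hC x).
  - by apply: gdom_int; apply: gdomZ; exact: gdom_gauss.
  - move=> t x _; rewrite normrM normrN; apply: le_trans (hC x).
    by rewrite ler_piMr// sin_max.
apply: (has_deriv_eq h) => t; rewrite mulNr -sine_Xgaussian// /sine_transform -integN.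
  by congr integ; apply/funext => x; ring.
exact: gdom_sin.
Qed.

(** The transform and the Gaussian on the right solve the same linear differential
    equation in t. *)
Lemma cosine_gaussian c t : 2 <= c ->
  cosine_transform (gaussian c) t = Num.sqrt (pi / c) * gaussian (4 * c)^-1 t.
Proof.
move=> c2; have c0 : c != 0 by rewrite gt_eqF//; lra.
have h : has_deriv (fun t => cosine_transform (gaussian c) t * gaussian (- (4 * c)^-1) t) (fun=> 0).
  apply: (has_deriv_eq (has_derivM (has_deriv_cosine_gaussian c2) (@has_deriv_gaussian _))) => s.
  by field.
have := has_deriv0_cst h t 0.
rewrite [gaussian _ 0]/gaussian expr0n mulr0 expR0 mulr1.
rewrite (_ : cosine_transform (gaussian c) 0 = Num.sqrt (pi / c)); last first.
  rewrite -integ_gaussian; last by lra.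
  by congr integ; apply/funext => x; rewrite mul0r cos0 mulr1.
move=> <-; rewrite -mulrA /gaussian -expRD.
by rewrite (_ : _ + _ = 0) ?expR0 ?mulr1//; ring.
Qed.

End Line.

(** * Symmetric sums over the integers *)

Definition zsum (V : zmodType) (f : int -> V) (n : nat) : V :=
  \sum_(i < n.*2.+1) f (i%:Z - n%:Z).

Lemma zsum0 (V : zmodType) (f : int -> V) : zsum f 0 = f 0.
Proof. by rewrite /zsum big_ord_recl big_ord0 addr0. Qed.

Lemma zsumS (V : zmodType) (f : int -> V) n :
  zsum f n.+1 = zsum f n + (f n.+1%:Z + f (- n.+1%:Z)).
Proof.
rewrite /zsum doubleS big_ord_recl big_ord_recr /= [RHS]addrA [RHS]addrC.
congr (_ + (_ + _)).
- by congr f; rewrite sub0r.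
- by apply: eq_bigr => i _; congr f; rewrite /bump /= add1n -!natz -!natr1; ring.
- by congr f; rewrite /bump /= add1n -!natz -addnn -!natr1 natrD; ring.
Qed.

Section SeqLemmas.
Context {R : realType}.
Implicit Types (u v : nat -> R).

Lemma dominated_steps u v : (forall n, `|u n.+1 - u n| <= v n.+1 - v n) ->
  forall n m, (n <= m)%N -> `|u m - u n| <= v m - v n.
Proof.
move=> h n m /subnK <-; elim: (m - n)%N => [|d IH].
  by rewrite add0n !subrr normr0.
have -> : u (d.+1 + n)%N - u n = (u (d + n).+1 - u (d + n)%N) + (u (d + n)%N - u n).
  by rewrite addrA subrK.
apply: (le_trans (ler_normD _ _)); apply: (le_trans (lerD (h _) IH)).
by rewrite addrA subrK.
Qed.

(** Comparison test for partial sums. Stating it for the sequences of partial sums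
    lets it apply to sums over the integers and over boxes of a lattice alike. *)
Lemma dominated_cvgn u v B : (forall n, `|u n.+1 - u n| <= v n.+1 - v n) ->
  (forall n, v n <= B) -> cvgn u.
Proof.
move=> h hB.
have nd : nondecreasing_seq v.
  move=> n m nm; rewrite -subr_ge0; apply: le_trans (dominated_steps h nm).
  exact: normr_ge0.
have cv : cvgn v.
  by apply: nondecreasing_is_cvgn => //; exists B => _ [n _ <-].
have cuv : cvgn (fun n => u n + v n).
  apply: nondecreasing_is_cvgn.
    move=> n m nm; have := dominated_steps h nm.
    by rewrite ler_norml => /andP[? _]; lra.
  exists (u 0 + (B - v 0) + B) => _ [n _ <-]; apply: lerD => //.
  have := dominated_steps h (leq0n n); have := hB n.
  by rewrite ler_norml => ? /andP[_ ?]; lra.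
have -> : u = (fun n => (u n + v n) - v n) by apply/funext => n; rewrite addrK.
exact: is_cvgB.
Qed.

Lemma zsum_le (f g : int -> R) n : (forall m, f m <= g m) -> zsum f n <= zsum g n.
Proof. by move=> h; apply: ler_sum. Qed.

Lemma zsumZ (c : R) (f : int -> R) n : zsum (fun m => c * f m) n = c * zsum f n.
Proof. by rewrite /zsum mulr_sumr. Qed.

Lemma zsum_inv_sqr_bound n : zsum (fun m : int => (1 + (m%:~R : R) ^+ 2)^-1) n <= 5.
Proof.
(* The correction 4 / (n + 1) decreases fast enough to absorb the two new terms,
   and makes the case n = 0 an equality. *)
suff : zsum (fun m : int => (1 + (m%:~R : R) ^+ 2)^-1) n <= 5 - 4 / n.+1%:R.
  by move=> /le_trans; apply; rewrite gerBl divr_ge0.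
elim: n => [|n IH].
  by rewrite zsum0 mulr0z expr0n /= addr0 invr1; lra.
rewrite zsumS mulrNz sqrrN -mulr2n; set x : R := _ ^+ 2.
have -> : x = n.+1%:R ^+ 2 by [].
have n1 : 0 < n.+1%:R :> R by [].
apply: (le_trans (lerD IH (lexx _))).
rewrite -!natr1 in n1 *; set y : R := n%:R in n1 *.
have y0 : 0 <= y by exact: ler0n.
rewrite -subr_ge0 (_ : _ - _ = (2 * (y ^+ 2 + y) + 4) / ((y + 1) * (y + 1 + 1) * (1 + (y + 1) ^+ 2))).
  have y2 := sqr_ge0 y; have y3 := sqr_ge0 (y + 1).
  by apply: divr_ge0; [nra|rewrite !mulr_ge0//; lra].
by field; rewrite !gt_eqF// ?ltr_wpDr//; nra.
Qed.

Definition zweight (a : R) (m : int) : R := (1 + (m%:~R + a) ^+ 2)^-1.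

Lemma zweight_gt0 a m : 0 < zweight a m.
Proof. by rewrite invr_gt0 ltr_wpDr// sqr_ge0. Qed.

Lemma zweight_bound a n : zsum (zweight a) n <= 10 * (1 + a ^+ 2).
Proof.
have a2 := sqr_ge0 a.
apply: (@le_trans _ _ (zsum (fun m : int => (2 * (1 + a ^+ 2)) * (1 + (m%:~R : R) ^+ 2)^-1) n)).
  apply: zsum_le => m; rewrite /zweight; set x : R := m%:~R.
  have x2 := sqr_ge0 x; have xa := sqr_ge0 (x + a).
  rewrite ler_pdivlMr ?ltr_wpDr// mulrC ler_pdivrMr ?ltr_wpDr//.
  have := sqr_ge0 (x + a + a); have := mulr_ge0 a2 xa; rewrite !expr2; nra.
rewrite zsumZ; have := zsum_inv_sqr_bound n; nra.
Qed.

Lemma zsum_cvg a C (f : int -> R) : (forall m, `|f m| <= C * zweight a m) ->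
  cvgn (zsum f).
Proof.
move=> h; apply: (@dominated_cvgn _ (fun n => C * zsum (zweight a) n) (C * (10 * (1 + a ^+ 2)))).
  move=> n; rewrite !zsumS [zsum f n + _]addrC addrK -mulrBr [zsum _ n + _]addrC addrK.
  by rewrite mulrDr; apply: (le_trans (ler_normD _ _)); apply: lerD.
move=> n; apply: ler_wpM2l; last exact: zweight_bound.
have := h 0; rewrite -(pmulr_lge0 _ (zweight_gt0 a 0)); exact: le_trans.
Qed.

End SeqLemmas.

(** * The Fejer kernel *)

Section Fejer.
Context {R : realType}.
Implicit Types (a b c t x y z e : R).

(** The usual Dirichlet kernel at y is [dirichlet M (pi * y)]. *)
Definition dirichlet (M : nat) z : R := zsum (fun l : int => cos (2 * l%:~R * z)) M.

Lemma dirichletS M z : dirichlet M.+1 z = dirichlet M z + 2 * cos (2 * M.+1%:R * z).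
Proof.
rewrite /dirichlet zsumS; congr (_ + _).
by rewrite mulrNz mulrN mulNr cosN -mulr2n [RHS]mulr_natl.
Qed.

Lemma zsum_cos A z M :
  zsum (fun l : int => cos (A + 2 * l%:~R * z)) M = cos A * dirichlet M z.
Proof.
elim: M => [|M IH].
  by rewrite /dirichlet !zsum0 mulr0z mulr0 mul0r addr0 cos0 mulr1.
rewrite zsumS IH dirichletS mulrDr; congr (_ + _).
by rewrite mulrNz mulrN mulNr !cosD cosN sinN; ring.
Qed.

Lemma sin_dirichlet M z : sin z * dirichlet M z = sin ((2 * M%:R + 1) * z).
Proof.
elim: M => [|M IH].
  by rewrite /dirichlet zsum0 mulr0z !mulr0 mul0r cos0 mulr1 add0r mul1r.
rewrite dirichletS mulrDr IH -[M.+1%:R]natr1.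
set w := (2 * M%:R + 1 + 1) * z.
have -> : (2 * M%:R + 1) * z = w - z by rewrite /w; ring.
have -> : (2 * (M%:R + 1) + 1) * z = w + z by rewrite /w; ring.
have -> : 2 * (M%:R + 1) * z = w by rewrite /w; ring.
by rewrite !sinD sinN cosN; ring.
Qed.

(** Multiplied by sin z, the Dirichlet kernels telescope to a square, whence the
    positivity of their means and the decay of those away from the integers. *)
Lemma sin_sum_dirichlet L z :
  sin z ^+ 2 * \sum_(M < L) dirichlet M z = sin (L%:R * z) ^+ 2.
Proof.
elim: L => [|L IH]; first by rewrite big_ord0 mul0r sin0 expr0n mulr0.
rewrite big_ord_recr mulrDr IH expr2 -mulrA sin_dirichlet -[L.+1%:R]natr1.
set w := L%:R * z.
have -> : (2 * L%:R + 1) * z = w + (w + z) by rewrite /w; ring.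
have -> : (L%:R + 1) * z = w + z by rewrite /w; ring.
rewrite (sinD w (w + z)) (cosD w z) (sinD w z) /=.
have := cos2Dsin2 w; have := cos2Dsin2 z; nra.
Qed.

(** At the zeros of sin z the telescoping identity carries no information, and
    positivity is seen directly. *)
Lemma dirichlet_sin0 M z : sin z = 0 -> dirichlet M z = 2 * M%:R + 1.
Proof.
move=> s0.
have c2 : cos (2 * z) = 1 by rewrite mulr_natl cos_mulr2n cos2sin2 s0; ring.
have s2 : sin (2 * z) = 0 by rewrite mulr_natl sin_mulr2n s0 mulr0 mul0rn.
have H : forall l : nat, cos (2 * l%:R * z) = 1 /\ sin (2 * l%:R * z) = 0.
  elim=> [|l [IH1 IH2]]; first by rewrite mulr0 mul0r cos0 sin0.
  have -> : 2 * l.+1%:R * z = 2 * l%:R * z + 2 * z by rewrite -[l.+1%:R]natr1; ring.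
  by rewrite cosD sinD IH1 IH2 c2 s2; split; ring.
elim: M => [|M IH].
  by rewrite /dirichlet zsum0 mulr0z !mulr0 mul0r cos0 add0r.
by rewrite dirichletS IH (H _).1 -[M.+1%:R]natr1; ring.
Qed.

Definition fejer (L : nat) z : R := L.+1%:R^-1 * \sum_(M < L.+1) dirichlet M z.

Lemma fejer_ge0 L z : 0 <= fejer L z.
Proof.
apply: mulr_ge0; first by rewrite invr_ge0.
have [s0|s0] := eqVneq (sin z) 0.
  by apply: sumr_ge0 => M _; rewrite dirichlet_sin0// addr_ge0// mulr_ge0.
rewrite -(@pmulr_rge0 _ (sin z ^+ 2)) ?sin_sum_dirichlet ?sqr_ge0//.
by rewrite exprn_even_gt0.
Qed.

Lemma sin_fejer L z : sin z ^+ 2 * fejer L z <= L.+1%:R^-1.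
Proof.
rewrite /fejer mulrCA ger_pMr ?invr_gt0// sin_sum_dirichlet.
by rewrite sin2cos2 gerBl sqr_ge0.
Qed.

(** A weak form of Jordan's inequality sin z >= 2z/pi; any positive constant
    suffices for the concentration of the Fejer kernel. *)
Lemma sin_ge_quarter z : 0 <= z <= pi / 2 -> z / 4 <= sin z.
Proof.
move=> /andP[z0 zpi].
have pi4 : pi <= 4 :> R by have := @pihalf_lt2 R; lra.
have h := has_derivB (@has_deriv_sin R) (has_derivM (@has_deriv_id R) (@has_deriv_cos R)).
have H : z * cos z <= sin z.
  have := has_deriv_ndecr h (a := 0) (b := z).
  rewrite sin0 mul0r !subr0 => H; rewrite -subr_ge0; apply: H => // x /andP[x0 xz].
  rewrite mul1r opprD addrA subrr sub0r mulrN opprK mulr_ge0 ?ltW//.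
  by rewrite sin_gt0_pihalf// x0 (lt_le_trans xz).
have c0 : 0 <= cos z by apply: cos_ge0_pihalf; apply/andP; split; lra.
have s0 : 0 <= sin z by apply: sin_ge0_pi; apply/andP; split; lra.
have := cos2Dsin2 z.
have [h1|h1] := leP (1 / 2) (cos z); first by nra.
move=> h2; have : 1 / 2 <= sin z by nra.
by nra.
Qed.

Lemma sqr_le_sin y : `|y| <= 1 / 2 -> y ^+ 2 <= 4 * sin (pi * y) ^+ 2.
Proof.
move=> hy; have pi2 : 2 <= pi :> R by have := @pihalf_ge1 R; lra.
have -> : sin (pi * y) ^+ 2 = sin (pi * `|y|) ^+ 2.
  by have [_|_] := ler0P y; rewrite // mulrN sinN sqrrN.
rewrite -(real_normK (num_real y)).
suff H t : 0 <= t -> t <= 1 / 2 -> t ^+ 2 <= 4 * sin (pi * t) ^+ 2 by exact: H.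
move=> h1 h2; have h3 : t * pi / 4 <= sin (t * pi).
  by apply: sin_ge_quarter; apply/andP; split; nra.
rewrite (mulrC pi); have : t / 2 <= sin (t * pi) by nra.
by nra.
Qed.

Lemma sqr_sin_shift (n : int) z : sin (z + pi * n%:~R) ^+ 2 = sin z ^+ 2.
Proof.
have H (m : nat) w : sin (w + pi * m%:R) ^+ 2 = sin w ^+ 2.
  elim: m => [|m IH]; first by rewrite mulr0 addr0.
  by rewrite -[m.+1%:R]natr1 mulrDr mulr1 addrA sinDpi sqrrN.
case: n => n; first exact: H.
by rewrite NegzE mulrNz mulrN -[in RHS](subrK (pi * n.+1%:R) z) H.
Qed.

(** Pointwise form of: the Fejer kernel has small first absolute moment over a
    period. The second moment is easy because sin^2 times the kernel is at most
    1/(L+1), and |y| <= e + y^2/e reduces the first moment to the second. *)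
Lemma fejer_first_moment L (n : int) e x : 0 < e -> `|x - n%:~R| <= 1 / 2 ->
  `|x - n%:~R| * fejer L (pi * x) <= e * fejer L (pi * x) + 4 / e * L.+1%:R^-1.
Proof.
move=> e0 hx; have := sqr_le_sin hx.
have -> : pi * (x - n%:~R) = pi * x + pi * (- n)%:~R by rewrite mulrNz; ring.
rewrite sqr_sin_shift -(real_normK (num_real (x - n%:~R))).
have := fejer_ge0 L (pi * x); have := sin_fejer L (pi * x).
have := normr_ge0 (x - n%:~R).
suff H (y K s l : R) : 0 <= y -> s * K <= l -> 0 <= K -> y ^+ 2 <= 4 * s ->
    y * K <= e * K + 4 / e * l by exact: H.
move=> y0 h1 h2 h3.
have hy : y <= e + y ^+ 2 / e.
  rewrite -subr_ge0 (_ : _ - _ = ((y - e) ^+ 2 + e * y) / e); last by field; rewrite gt_eqF.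
  apply: divr_ge0; last exact: ltW.
  by rewrite addr_ge0 ?sqr_ge0// mulr_ge0// ltW.
apply: (@le_trans _ _ ((e + y ^+ 2 / e) * K)); first by rewrite ler_wpM2r.
rewrite mulrDl lerD2l (mulrAC (y ^+ 2)) [4 / e * l]mulrAC.
apply: ler_wpM2r; first by rewrite invr_ge0 ltW.
by have := ler_wpM2r h2 h3; lra.
Qed.

(** A primitive of the kernel that increases by exactly 1 over a period, from which
    the mass of the kernel is read off. *)
Definition dirichlet_prim (M : nat) y : R :=
  y + \sum_(l < M) sin (2 * pi * l.+1%:R * y) / (pi * l.+1%:R).

Lemma dirichletE M z : dirichlet M z = 1 + \sum_(l < M) 2 * cos (2 * l.+1%:R * z).
Proof.
elim: M => [|M IH].
  by rewrite /dirichlet zsum0 mulr0z mulr0 mul0r cos0 big_ord0 addr0.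
by rewrite dirichletS IH big_ord_recr /= addrA.
Qed.

Lemma has_deriv_sum (I : Type) (s : seq I) (F dF : I -> R -> R) :
  (forall i, has_deriv (F i) (dF i)) ->
  has_deriv (fun x => \sum_(i <- s) F i x) (fun x => \sum_(i <- s) dF i x).
Proof.
move=> h; elim: s => [|i s IH].
  have -> : (fun x => \sum_(i <- [::]) F i x) = fun=> 0.
    by apply/funext => x; rewrite big_nil.
  by apply: (has_deriv_eq (has_deriv_cst 0)) => x; rewrite big_nil.
have -> : (fun x => \sum_(j <- i :: s) F j x) = fun x => F i x + \sum_(j <- s) F j x.
  by apply/funext => x; rewrite big_cons.
by apply: (has_deriv_eq (has_derivD (h i) IH)) => x; rewrite big_cons.
Qed.

Lemma has_deriv_dirichlet_prim M b :
  has_deriv (fun x => dirichlet_prim M (x - b)) (fun x => dirichlet M (pi * (x - b))).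
Proof.
have h : has_deriv (dirichlet_prim M) (fun y => dirichlet M (pi * y)).
  have p0 : pi != 0 :> R by rewrite gt_eqF// pi_gt0.
  have H := has_derivD (@has_deriv_id R) (has_deriv_sum (index_enum 'I_M)
    (fun l : 'I_M => has_derivZ (pi * l.+1%:R)^-1 (@has_deriv_sinm R (2 * pi * l.+1%:R)))).
  have -> : dirichlet_prim M = fun x => x + \sum_(l < M) (pi * l.+1%:R)^-1 * sin (2 * pi * l.+1%:R * x).
    by apply/funext => x; congr (_ + _); apply: eq_bigr => l _; rewrite mulrC.
  apply: (has_deriv_eq H) => y; rewrite dirichletE; congr (_ + _).
  apply: eq_bigr => l _.
  have l0 : l.+1%:R != 0 :> R by rewrite pnatr_eq0.
  have -> : 2 * l.+1%:R * (pi * y) = 2 * pi * l.+1%:R * y by ring.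
  by move: l.+1%:R l0 (@pi R) p0 {H} => q q0 p p0; field; rewrite q0 p0.
have h2 := has_deriv_comp h (has_derivB (@has_deriv_id R) (has_deriv_cst b)).
by apply: (has_deriv_eq h2) => x; rewrite subr0 mul1r.
Qed.

Lemma sin_period (l : nat) y : sin (y + 2 * pi * l%:R) = sin y.
Proof.
elim: l y => [|l IH] y; first by rewrite mulr0 addr0.
by rewrite -[l.+1%:R]natr1 mulrDr mulr1 addrA [2 * pi in X in _ + X]mulr_natl sinD2pi IH.
Qed.

Lemma dirichlet_prim_period M y : dirichlet_prim M (y + 1) = dirichlet_prim M y + 1.
Proof.
rewrite /dirichlet_prim addrAC; congr (_ + _ + _); apply: eq_bigr => l _.
by rewrite mulrDr mulr1 sin_period.
Qed.

Definition fejer_prim L y : R := L.+1%:R^-1 * \sum_(M < L.+1) dirichlet_prim M y.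

Lemma has_deriv_fejer_prim L b :
  has_deriv (fun x => fejer_prim L (x - b)) (fun x => fejer L (pi * (x - b))).
Proof.
apply: has_derivZ; apply: has_deriv_sum => M; exact: has_deriv_dirichlet_prim.
Qed.

Lemma fejer_prim_period L y : fejer_prim L (y + 1) = fejer_prim L y + 1.
Proof.
rewrite /fejer_prim; under eq_bigr do rewrite dirichlet_prim_period.
rewrite big_split /= mulrDr; congr (_ + _).
by rewrite sumr_const card_ord mulVf// pnatr_eq0.
Qed.

Lemma continuous_ext (f g : R -> R) : f =1 g -> continuous g -> continuous f.
Proof. by move=> /funext ->. Qed.

Lemma continuous_dirichlet M b : continuous (fun x => dirichlet M (pi * (x - b))).
Proof.
have h := has_derivD (has_deriv_cst 1) (has_deriv_sum (index_enum 'I_M)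
  (fun l : 'I_M => has_derivZ 2 (@has_deriv_cosl R (2 * pi * l.+1%:R) (- (2 * pi * l.+1%:R * b))))).
apply: (continuous_ext _ (has_deriv_continuous h)) => x.
by rewrite dirichletE; congr (_ + _); apply: eq_bigr => l _; congr (_ * cos _); ring.
Qed.

Lemma continuous_sum (I : Type) (s : seq I) (F : I -> R -> R) : (forall i, continuous (F i)) ->
  continuous (fun x => \sum_(i <- s) F i x).
Proof.
move=> h; elim: s => [|i s IH].
  by under eq_fun do rewrite big_nil; move=> x; exact: cvg_cst.
by under eq_fun do rewrite big_cons; exact: continuous_add.
Qed.

Lemma continuous_fejer L b : continuous (fun x => fejer L (pi * (x - b))).
Proof.
apply: continuous_mul; first by move=> x; exact: cvg_cst.
by apply: continuous_sum => M; exact: continuous_dirichlet.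
Qed.

End Fejer.

(** * Poisson summation for Gaussians *)

Section Poisson.
Context {R : realType}.
Implicit Types (f F dF h : R -> R) (a b c t x y z e p q r M : R).
Local Notation mu := (@lebesgue_measure R).

Lemma continuous_itv_int h p q : continuous h -> mu.-integrable `[p, q] (EFin \o h).
Proof.
move=> ch; apply: continuous_compact_integrable; first exact: segment_compact.
exact: continuous_subspaceT.
Qed.

Lemma integ_itv_cat h p q r : continuous h -> p <= q -> q <= r ->
  \int[mu]_(x in `[p, r]) h x = \int[mu]_(x in `[p, q]) h x + \int[mu]_(x in `[q, r]) h x.
Proof.
move=> ch pq qr.
have H := @Rintegral_itvB R h (BLeft p) (BRight r) q (continuous_itv_int p r ch).
rewrite -[X in _ = _ + X]Rintegral_itv_obnd_cbnd; last first.
  apply: integrableS (continuous_itv_int q r ch) => //.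
  by apply: subset_itvr; rewrite bnd_simp.
by rewrite -H ?bnd_simp//; ring.
Qed.

(** Over the window of length 1 centred at b + n the kernel acts as a unit mass at
    b + n, up to an error controlled by the first moment of the kernel and the size
    of F' there. *)
Lemma fejer_window L b (n : int) F dF M e : 0 < e -> has_deriv F dF ->
  (forall x, `|x - b - n%:~R| <= 1 / 2 -> `|dF x| <= M) ->
  `| \int[mu]_(x in `[b + n%:~R - 2^-1, b + n%:~R + 2^-1]) (F x * fejer L (pi * (x - b)))
     - F (b + n%:~R) | <= M * (e + 4 / e * L.+1%:R^-1).
Proof.
move=> e0 hF hM; set k := fun x => fejer L (pi * (x - b)).
set m : R := n%:~R.
have ck : continuous k by exact: continuous_fejer.
have hk := @has_deriv_fejer_prim R L b.
have cF := has_deriv_continuous hF.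
have lr : b + m - 2^-1 <= b + m + 2^-1 by lra.
have k1 : \int[mu]_(x in `[b + m - 2^-1, b + m + 2^-1]) k x = 1.
  rewrite (integ_itv hk)//.
  have -> : b + m + 2^-1 - b = (b + m - 2^-1 - b) + 1 by lra.
  by rewrite fejer_prim_period; ring.
have M0 : 0 <= M.
  by apply: le_trans (hM (b + m) _); rewrite // [b + m]addrC addrK subrr normr0.
have cFk : continuous (fun x => F x * k x) by exact: continuous_mul.
have cst_c (d : R) : continuous (fun _ : R => d) by move=> x; exact: cvg_cst.
have cD : continuous (fun x => F x * k x - F (b + m) * k x).
  by apply: continuous_sub => //; exact: continuous_mul.
have -> : \int[mu]_(x in `[b + m - 2^-1, b + m + 2^-1]) (F x * k x) - F (b + m) =
    \int[mu]_(x in `[b + m - 2^-1, b + m + 2^-1]) (F x * k x - F (b + m) * k x).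
  rewrite RintegralB//; try exact: continuous_itv_int.
    rewrite RintegralZl ?k1 ?mulr1//; exact: continuous_itv_int.
  by apply: continuous_itv_int; exact: continuous_mul.
have iD := continuous_itv_int (b + m - 2^-1) (b + m + 2^-1) cD.
apply: (le_trans (le_normr_Rintegral _ iD)) => //.
(* An integrable majorant whose primitive is known. *)
pose up x := M * (e * k x + 4 / e * L.+1%:R^-1 * 1).
have cup : continuous up.
  exact: continuous_mul (cst_c M) (continuous_add (continuous_mul (cst_c e) ck) (cst_c _)).
have hup := has_derivZ M (has_derivD (has_derivZ e hk)
  (has_derivZ (4 / e * L.+1%:R^-1) (@has_deriv_id R))).
have -> : M * (e + 4 / e * L.+1%:R^-1) = \int[mu]_(x in `[b + m - 2^-1, b + m + 2^-1]) up x.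
  rewrite (integ_itv hup)//.
  have -> : b + m + 2^-1 - b = (b + m - 2^-1 - b) + 1 by lra.
  rewrite fejer_prim_period -mulrBr; congr (M * _).
  by move: (4 / e * L.+1%:R^-1) (fejer_prim _ _) => c P; lra.
apply: le_Rintegral => //.
- apply: (continuous_itv_int (h := fun x => `|F x * k x - F (b + m) * k x|)) => x.
  exact: (@continuous_comp _ _ _ _ (@Num.norm R R) x (cD x) (@norm_continuous _ _ _)).
- exact: continuous_itv_int.
move=> x; rewrite /= in_itv /= => /andP[x1 x2].
have xn : `|x - b - m| <= 1 / 2 by rewrite ler_norml; apply/andP; split; lra.
have k0 : 0 <= k x by exact: fejer_ge0.
rewrite -mulrBl normrM (ger0_norm k0) /up mulr1.
apply: (@le_trans _ _ (M * `|x - b - m| * k x)).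
  apply: ler_wpM2r => //.
  have [le|/ltW le] := leP (b + m) x.
  - apply: (le_trans (has_deriv_lip hF (C := M) _ le)).
      by move=> y /andP[y1 y2]; apply: hM; rewrite ler_norml; apply/andP; split; lra.
    by rewrite ger0_norm; [|lra]; rewrite (_ : x - b - m = x - (b + m)) //; ring.
  - rewrite distrC; apply: (le_trans (has_deriv_lip hF (C := M) _ le)).
      by move=> y /andP[y1 y2]; apply: hM; rewrite ler_norml; apply/andP; split; lra.
    by rewrite ler0_norm; [|lra]; rewrite (_ : - (x - b - m) = b + m - x) //; ring.
rewrite -mulrA; apply: ler_wpM2l => //.
exact: fejer_first_moment.
Qed.

Lemma fejer_windows L b F dF e (B : int -> R) N : 0 < e -> has_deriv F dF ->
  (forall (n : int) x, `|x - b - n%:~R| <= 1 / 2 -> `|dF x| <= B n) ->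
  `| \int[mu]_(x in `[b - N%:R - 2^-1, b + N%:R + 2^-1]) (F x * fejer L (pi * (x - b)))
     - zsum (fun n : int => F (b + n%:~R)) N | <= zsum B N * (e + 4 / e * L.+1%:R^-1).
Proof.
move=> e0 hF hM; elim: N => [|N IH].
  rewrite !zsum0; have := @fejer_window L b 0 F dF (B 0) e e0 hF (hM 0).
  by rewrite !(mulr0z, mulr0n, subr0, addr0).
have N0 : 0 <= N%:R :> R by [].
have cFk : continuous (fun x => F x * fejer L (pi * (x - b))).
  by apply: continuous_mul; [exact: has_deriv_continuous hF|exact: continuous_fejer].
rewrite !zsumS.
have W1 := @fejer_window L b N.+1%:Z F dF _ e e0 hF (hM _).
have W2 := @fejer_window L b (- N.+1%:Z) F dF _ e e0 hF (hM _).
rewrite (integ_itv_cat (q := b - N%:R - 2^-1) cFk); last 2 first.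
- by rewrite -[N.+1%:R]natr1; lra.
- by rewrite -[N.+1%:R]natr1; lra.
rewrite (integ_itv_cat (p := b - N%:R - 2^-1) (q := b + N%:R + 2^-1) cFk); last 2 first.
- lra.
- by rewrite -[N.+1%:R]natr1; lra.
have SN : N.+1%:Z%:~R = N%:R + 1 :> R by rewrite natr1.
move: W1 W2; rewrite !mulrNz.
have -> : b + N.+1%:Z%:~R - 2^-1 = b + N%:R + 2^-1.
  by rewrite SN; lra.
have -> : b - N.+1%:Z%:~R + 2^-1 = b - N%:R - 2^-1.
  by rewrite SN; lra.
move: IH; rewrite !mulrDl.
set j0 := Rintegral _ _ _; set j1 := Rintegral _ _ _; set j2 := Rintegral _ _ _.
set s := zsum _ _; set f1 := F _; set f2 := F _.
move=> h0 h1 h2.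
have -> : j2 + (j0 + j1) - (s + (f1 + f2)) = (j0 - s) + ((j1 - f1) + (j2 - f2)) by ring.
apply: (le_trans (ler_normD _ _)); apply: lerD => //.
by apply: (le_trans (ler_normD _ _)); apply: lerD.
Qed.

End Poisson.

Section Theta.
Context {R : realType}.
Implicit Types (f F dF h : R -> R) (a b c t x y z e p q r : R).
Local Notation mu := (@lebesgue_measure R).

Lemma integ_gaussian_cos c t p : 2 <= c ->
  integ (fun x => gaussian c x * cos (t * x + p)) = cos p * cosine_transform (gaussian c) t.
Proof.
move=> c2; have gc := gdom_gaussian c2.
have s0 : sine_transform (gaussian c) t = 0.
  have := integ_opp (gdom_sin t gc); rewrite -/(sine_transform _ _) => <-.
  have e : sine_transform (gaussian c) t = - integ (fun x => gaussian c (- x) * sin (t * (- x))).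
    rewrite -integN; last first.
      have := gdomN (gdom_sin t gc); congr gauss_dominated; apply/funext => x.
      by rewrite /gaussian mulrN sinN sqrrN mulrN.
    by congr integ; apply/funext => x; rewrite /gaussian mulrN sinN sqrrN mulrN opprK.
  have := integ_opp (gdom_sin t gc); rewrite -/(sine_transform _ _) => e2.
  by rewrite -e2 in e; lra.
have -> : (fun x => gaussian c x * cos (t * x + p)) =
    (fun x => cos p * (gaussian c x * cos (t * x)) - sin p * (gaussian c x * sin (t * x))).
  by apply/funext => x; rewrite cosD; ring.
rewrite integB; [|exact/gdomZ/gdom_cos|exact/gdomZ/gdom_sin].
rewrite !integZ; [|exact: gdom_sin|exact: gdom_cos].
by rewrite -/(sine_transform _ _) s0 mulr0 subr0.
Qed.

(** The phase t serves to treat real and imaginary parts of the exponential at once: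
    t = 0 gives the cosine and t = pi/2 minus the sine. *)
Definition modulated_gaussian c a t x : R := gaussian c x * cos (2 * pi * a * x + t).

(** The kernel is a mean of Dirichlet kernels, that is of symmetric sums of
    exponentials, and each exponential shifts the frequency of the Gaussian: the
    integral is a Cesaro mean of the dual series. *)
Lemma integ_modulated_gaussian_fejer L c a b t : 2 <= c ->
  integ (fun x => modulated_gaussian c a t x * fejer L (pi * (x - b))) =
  L.+1%:R^-1 * \sum_(M < L.+1) zsum (fun l : int =>
    Num.sqrt (pi / c) * gaussian (pi ^+ 2 / c) (l%:~R + a) * cos (2 * pi * l%:~R * b - t)) M.
Proof.
move=> c2; have gc := gdom_gaussian c2.
pose G (l : int) x := gaussian c x * cos (2 * pi * (a + l%:~R) * x + (t - 2 * pi * l%:~R * b)).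
have gG l : gauss_dominated (G l) by exact: gdom_cosl.
have -> : (fun x => modulated_gaussian c a t x * fejer L (pi * (x - b))) =
    (fun x => L.+1%:R^-1 * \sum_(M < L.+1) zsum (G ^~ x) M).
  apply/funext => x; rewrite /fejer mulrCA; congr (_ * _).
  rewrite mulr_sumr; apply: eq_bigr => M _.
  rewrite /modulated_gaussian -[_ * cos _ * _]mulrA -zsum_cos -zsumZ; apply: eq_bigr => i _.
  by rewrite /G; congr (_ * cos _); ring.
have gz (M : nat) : gauss_dominated (fun x => zsum (G ^~ x) M) by apply: gdom_sum.
rewrite integZ; last by apply: gdom_sum => M.
congr (_ * _); rewrite integ_sum//; apply: eq_bigr => M _.
rewrite /zsum integ_sum//; apply: eq_bigr => i _.
set l : int := _ - _; rewrite integ_gaussian_cos// cosine_gaussian//.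
have c0 : c != 0 by rewrite gt_eqF//; lra.
rewrite mulrC -[t - _]opprB cosN; congr (_ * _ * _).
rewrite /gaussian; congr expR.
by move: (@pi R) l%:~R => P m; field.
Qed.

Lemma modulated_gaussian_deriv_bound c a t : 2 <= c -> exists dF C, [/\ has_deriv (modulated_gaussian c a t) dF &
  forall (n : int) b x, `|x - b - n%:~R| <= 1 / 2 -> `|dF x| <= C * zweight b n].
Proof.
move=> c2.
exists (fun x => - (2 * c * x) * gaussian c x * cos (2 * pi * a * x + t) +
  gaussian c x * - (2 * pi * a * sin (2 * pi * a * x + t))).
exists (2 * (4 * c + 4 * pi * `|a|)); split.
  exact: has_derivM (has_deriv_gaussian c) (has_deriv_cosl _ _).
move=> n b x hx.
have pi0 : 0 <= pi :> R by exact: pi_ge0.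
have g0 := gaussian_gt0 c x; have g2 := gaussian_le x c2.
have b1 : `|x| * gaussian c x <= 2 * gauss_fun x.
  by apply: le_trans (gaussian2_bound 1 x); rewrite expr1 ler_wpM2l.
have b0 : gaussian c x <= 2 * gauss_fun x.
  by apply: le_trans (gaussian2_bound 0 x); rewrite expr0 mul1r.
have ck : 0 <= 4 * c + 4 * pi * `|a|.
  by rewrite addr_ge0 ?mulr_ge0//; lra.
apply: (@le_trans _ _ ((4 * c + 4 * pi * `|a|) * gauss_fun x)).
  apply: (le_trans (ler_normD _ _)); rewrite [_ * gauss_fun x]mulrDl; apply: lerD.
    rewrite !normrM normrN !normrM (ger0_norm (_ : 0 <= c)); last lra.
    rewrite (ger0_norm (_ : 0 <= 2)) // (gtr0_norm g0).
    apply: (@le_trans _ _ (2 * c * `|x| * gaussian c x)).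
      rewrite ler_piMr ?cos_max//; apply: mulr_ge0; last exact: ltW.
      by apply: mulr_ge0 => //; lra.
    have c20 : 0 <= 2 * c by lra.
    by have := ler_wpM2l c20 b1; rewrite -!mulrA; lra.
  rewrite !normrM normrN !normrM (ger0_norm (_ : 0 <= 2)) // (ger0_norm pi0) (gtr0_norm g0).
  apply: (@le_trans _ _ (gaussian c x * (2 * pi * `|a|))).
    by apply: ler_wpM2l; [exact: ltW|rewrite ler_piMr ?sin_max// !mulr_ge0].
  have pa : 0 <= pi * `|a| by rewrite mulr_ge0.
  by have := ler_wpM2l pa b0; lra.
rewrite [2 * _]mulrC -[_ * 2 * _]mulrA; apply: ler_wpM2l => //.
apply: (le_trans (gauss_fun_le_inv x)); rewrite /zweight.
rewrite ler_pdivlMr; last by rewrite ltr_wpDr// sqr_ge0.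
rewrite mulrC ler_pdivrMr; last by rewrite ltr_wpDr// sqr_ge0.
move: hx; rewrite ler_norml => /andP[h1 h2].
move: (n%:~R) h1 h2 => m h1 h2.
have h3 : (x - b - m) ^+ 2 <= 1 / 4 by nra.
by have := sqr_ge0 (x + x - (m + b)); nra.
Qed.

Lemma gaussian_zweight c b (n : int) : 0 < c ->
  gaussian c (n%:~R + b) <= (1 + c^-1) * zweight b n.
Proof.
move=> c0; set x := _ + b.
apply: (@le_trans _ _ ((1 + c * x ^+ 2)^-1)).
  rewrite /gaussian mulNr expRN lef_pV2 ?posrE ?expR_gt0 ?expR_ge1Dx//.
  by rewrite ltr_wpDr// mulr_ge0 ?sqr_ge0 ?ltW.
rewrite /zweight -/x; have x2 := sqr_ge0 x.
have cx : 0 <= c * x ^+ 2 by rewrite mulr_ge0// ltW.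
rewrite ler_pdivlMr ?ltr_wpDr// mulrC ler_pdivrMr ?ltr_wpDr//.
rewrite (_ : (1 + c^-1) * _ = 1 + x ^+ 2 + c^-1 + c * x ^+ 2); last by field; rewrite gt_eqF.
have : 0 < c^-1 by rewrite invr_gt0.
lra.
Qed.

(** The integral of the modulated Gaussian against the Fejer kernel tends to the
    dual series by Cesaro's lemma, and differs from the original series by at most
    B (e + 4 / (e (L + 1))) for every e > 0. *)
Lemma poisson_gaussian c a b t : 2 <= c -> exists l : R,
  (zsum (fun n : int => modulated_gaussian c a t (b + n%:~R)) @ \oo --> l) /\
  (zsum (fun l : int => Num.sqrt (pi / c) * gaussian (pi ^+ 2 / c) (l%:~R + a)
      * cos (2 * pi * l%:~R * b - t)) @ \oo --> l).
Proof.
move=> c2.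
have c0 : 0 < c by lra.
set f1 := zsum _; set f2 := zsum _.
have cv1 : cvgn f1.
  apply: (@zsum_cvg R b (1 + c^-1)) => n; rewrite normrM (gtr0_norm (gaussian_gt0 _ _)).
  apply: (@le_trans _ _ (gaussian c (n%:~R + b))); last exact: gaussian_zweight.
  by rewrite addrC ler_piMr ?cos_max// ltW// gaussian_gt0.
have cv2 : cvgn f2.
  apply: (@zsum_cvg R a (Num.sqrt (pi / c) * (1 + (pi ^+ 2 / c)^-1))) => n.
  rewrite !normrM (gtr0_norm (gaussian_gt0 _ _)) (ger0_norm (sqrtr_ge0 _)).
  apply: (@le_trans _ _ (Num.sqrt (pi / c) * gaussian (pi ^+ 2 / c) (n%:~R + a))).
    by rewrite ler_piMr ?cos_max// mulr_ge0 ?sqrtr_ge0// ltW// gaussian_gt0.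
  rewrite -[_ * _ * zweight _ _]mulrA ler_wpM2l ?sqrtr_ge0// gaussian_zweight// divr_gt0//.
  by rewrite exprn_gt0// pi_gt0.
exists (limn f1); split=> //.
suff -> : limn f1 = limn f2 by [].
have [dF [C [hd hC]]] := modulated_gaussian_deriv_bound a t c2.
pose B := C * (10 * (1 + b ^+ 2)).
have C0 : 0 <= C.
  have := hC 0 0 0; rewrite mulr0z !subr0 normr0 => H.
  rewrite -(pmulr_lge0 _ (zweight_gt0 (0 : R) 0)); apply: le_trans (H _); rewrite ?normr_ge0//.
have B0 : 0 <= B by rewrite !mulr_ge0// addr_ge0 ?sqr_ge0.
pose I L := integ (fun x => modulated_gaussian c a t x * fejer L (pi * (x - b))).
have key (L : nat) e : 0 < e -> `|I L - limn f1| <= B * (e + 4 / e * L.+1%:R^-1).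
  move=> e0.
  have gd : gauss_dominated (fun x => modulated_gaussian c a t x * fejer L (pi * (x - b))).
    have [K hK] : exists K, forall x, `|fejer L (pi * (x - b))| <= K.
      exists (L.+1%:R^-1 * \sum_(M < L.+1) \sum_(i < M.*2.+1) 1) => x.
      rewrite /fejer normrM ger0_norm ?invr_ge0// ler_wpM2l ?invr_ge0//.
      apply: (le_trans (ler_norm_sum _ _ _)); apply: ler_sum => M _.
      apply: (le_trans (ler_norm_sum _ _ _)); apply: ler_sum => i _.
      exact: cos_max.
    apply: (gdomMb _ _ hK); first exact/gdom_cosl/gdom_gaussian.
    exact: continuous_fejer.
  have J := integ_cvg b gd.
  have D : `|\int[mu]_(x in `[b - N%:R - 2^-1, b + N%:R + 2^-1])
      (modulated_gaussian c a t x * fejer L (pi * (x - b))) - f1 N| @[N --> \oo] --> `|I L - limn f1|.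
    by apply: cvg_norm; apply: cvgB.
  apply: (cvgr_to_le D); apply: nearW => N.
  have H := @fejer_windows R L b _ _ e (fun n => C * zweight b n) N e0 hd.
  apply: (le_trans (H (fun n x => hC n b x))).
  apply: ler_wpM2r; last by rewrite zsumZ ler_wpM2l// zweight_bound.
  by rewrite addr_ge0 ?ltW// divr_gt0// divr_gt0.
have cI : I @ \oo --> limn f2.
  have := cesaro cv2; apply: cvg_trans; apply: near_eq_cvg; apply: nearW => L.
  rewrite /I integ_modulated_gaussian_fejer// /arithmetic_mean /= /series /=; congr (_ * _).
  by rewrite big_mkord.
apply/esym/eqP; rewrite -subr_eq0 -normr_le0; apply/ler_addgt0Pl => d d0.
rewrite addr0.
pose e := d / (B + 1).
have e0 : 0 < e by rewrite divr_gt0// ltr_wpDl.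
have cI2 : `|I n - limn f1| @[n --> \oo] --> `|limn f2 - limn f1|.
  by apply: cvg_norm; apply: cvgB => //; exact: cvg_cst.
have cE : (B * (e + 4 / e * n.+1%:R^-1)) @[n --> \oo] --> B * (e + 4 / e * 0).
  by apply: cvgM; [exact: cvg_cst|apply: cvgD; [exact: cvg_cst|apply: cvgM; [exact: cvg_cst|exact: cvg_harmonic]]].
apply: (@le_trans _ _ (B * (e + 4 / e * 0))).
  by apply: (ler_cvg_to cI2 cE); apply: nearW => n; exact: key.
rewrite mulr0 addr0 /e mulrA ler_pdivrMr ?ltr_wpDl//; nra.
Qed.

End Theta.

(** * Limits of complex sequences *)

Section ComplexLimits.
Context {R : realType}.
Implicit Types (u v : nat -> R[i]) (l z w : R[i]) (x y : R).

Lemma cReD z w : complex.Re (z + w) = complex.Re z + complex.Re w.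
Proof. by case: z; case: w. Qed.
Lemma cImD z w : complex.Im (z + w) = complex.Im z + complex.Im w.
Proof. by case: z; case: w. Qed.
Lemma cReM z w : complex.Re (z * w) =
  complex.Re z * complex.Re w - complex.Im z * complex.Im w.
Proof. by case: z; case: w. Qed.
Lemma cImM z w : complex.Im (z * w) =
  complex.Re z * complex.Im w + complex.Im z * complex.Re w.
Proof. by case: z; case: w. Qed.

Lemma cRe_sum (I : Type) (s : seq I) (P : pred I) (F : I -> R[i]) :
  complex.Re (\sum_(i <- s | P i) F i) = \sum_(i <- s | P i) complex.Re (F i).
Proof. by elim/big_rec2 : _ => // i x z _ <-; rewrite cReD. Qed.
Lemma cIm_sum (I : Type) (s : seq I) (P : pred I) (F : I -> R[i]) :
  complex.Im (\sum_(i <- s | P i) F i) = \sum_(i <- s | P i) complex.Im (F i).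
Proof. by elim/big_rec2 : _ => // i x z _ <-; rewrite cImD. Qed.

Lemma norm_Re_le_normc z : `|complex.Re z| <= Normc.normc z.
Proof. by case: z => a b /=; rewrite -sqrtr_sqr ler_wsqrtr// lerDl sqr_ge0. Qed.
Lemma norm_Im_le_normc z : `|complex.Im z| <= Normc.normc z.
Proof. by case: z => a b /=; rewrite -sqrtr_sqr ler_wsqrtr// lerDr sqr_ge0. Qed.
Lemma normc_le_ReIm z : Normc.normc z <= `|complex.Re z| + `|complex.Im z|.
Proof.
case: z => a b /=.
rewrite -[leRHS]ger0_norm ?addr_ge0// -sqrtr_sqr ler_wsqrtr//.
rewrite sqrrD !real_normK ?num_real//.
by rewrite -addrA [_ *+ 2 + _]addrC addrA lerDl mulrn_wge0// mulr_ge0.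
Qed.

Lemma normc_cis x : Normc.normc (cis x) = 1.
Proof. by rewrite /cis /= cos2Dsin2 sqrtr1. Qed.

Lemma cisD x y : cis (x + y) = cis x * cis y.
Proof. by rewrite /cis cosD sinD; apply/eqP; rewrite eq_complex /= [cos x * sin y + _]addrC !eqxx. Qed.

Lemma cis0 : cis 0 = 1 :> R[i].
Proof. by rewrite /cis cos0 sin0. Qed.

Lemma cis_sum (I : Type) (s : seq I) (P : pred I) (F : I -> R) :
  cis (\sum_(i <- s | P i) F i) = \prod_(i <- s | P i) cis (F i).
Proof. by elim/big_rec2 : _ => [|i x z _ <-]; rewrite ?cis0// cisD. Qed.

(** Convergence of real and imaginary parts, so that real integrals and limits can
    be used directly. *)
Definition ccvg u l := (fun n => complex.Re (u n)) @ \oo --> complex.Re l /\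
  (fun n => complex.Im (u n)) @ \oo --> complex.Im l.

Lemma ccvg_cst z : ccvg (fun=> z) z.
Proof. by split; exact: cvg_cst. Qed.

Lemma ccvgD u v l z : ccvg u l -> ccvg v z -> ccvg (fun n => u n + v n) (l + z).
Proof.
move=> [u1 u2] [v1 v2]; split.
  by rewrite cReD; under eq_fun do rewrite cReD; exact: cvgD.
by rewrite cImD; under eq_fun do rewrite cImD; exact: cvgD.
Qed.

Lemma ccvgM u v l z : ccvg u l -> ccvg v z -> ccvg (fun n => u n * v n) (l * z).
Proof.
move=> [u1 u2] [v1 v2]; split.
  rewrite cReM; under eq_fun do rewrite cReM.
  by apply: cvgB; apply: cvgM.
rewrite cImM; under eq_fun do rewrite cImM.
by apply: cvgD; apply: cvgM.
Qed.

Lemma ccvgMl u l z : ccvg u l -> ccvg (fun n => z * u n) (z * l).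
Proof. by move=> h; apply: ccvgM => //; exact: ccvg_cst. Qed.

Lemma ccvg_sum (I : Type) (s : seq I) (u : I -> nat -> R[i]) (l : I -> R[i]) :
  (forall i, ccvg (u i) (l i)) ->
  ccvg (fun n => \sum_(i <- s) u i n) (\sum_(i <- s) l i).
Proof.
move=> h; elim: s => [|i s IH].
  by rewrite big_nil; under eq_fun do rewrite big_nil; exact: ccvg_cst.
by rewrite big_cons; under eq_fun do rewrite big_cons; exact: ccvgD.
Qed.

Lemma ccvg_prod (I : Type) (s : seq I) (u : I -> nat -> R[i]) (l : I -> R[i]) :
  (forall i, ccvg (u i) (l i)) ->
  ccvg (fun n => \prod_(i <- s) u i n) (\prod_(i <- s) l i).
Proof.
move=> h; elim: s => [|i s IH].
  by rewrite big_nil; under eq_fun do rewrite big_nil; exact: ccvg_cst.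
by rewrite big_cons; under eq_fun do rewrite big_cons; exact: ccvgM.
Qed.

Lemma ccvg_unique u l z : ccvg u l -> ccvg u z -> l = z.
Proof.
move=> [u1 u2] [v1 v2]; apply/eqP; rewrite eq_complex.
by rewrite (cvg_unique _ u1 v1)// (cvg_unique _ u2 v2)// !eqxx.
Qed.

Lemma ccvg_bound u l B : ccvg u l -> (forall n, Normc.normc (u n) <= B) ->
  Normc.normc l <= 2 * B.
Proof.
move=> [u1 u2] h; apply: (le_trans (normc_le_ReIm _)); rewrite mulr2n mulrDl mul1r.
apply: lerD.
  apply: (cvgr_to_le (cvg_norm u1)); apply: nearW => n.
  by apply: le_trans (h n); exact: norm_Re_le_normc.
apply: (cvgr_to_le (cvg_norm u2)); apply: nearW => n.
by apply: le_trans (h n); exact: norm_Im_le_normc.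
Qed.

Definition clim u : R[i] := limn (fun n => complex.Re (u n)) +i* limn (fun n => complex.Im (u n)).

Lemma clim_ccvg u l : ccvg u l -> clim u = l.
Proof.
move=> [u1 u2]; rewrite /clim (cvg_lim _ u1)// (cvg_lim _ u2)//; by case: l u1 u2.
Qed.

Lemma near_ccvg u l N : (forall n, (N <= n)%N -> u n = l) -> ccvg u l.
Proof.
move=> h; split; apply: cvg_near_cst; near=> n; rewrite h//; near: n; exact: nbhs_infty_ge.
Unshelve. all: by end_near.
Qed.

Lemma normc_sum (I : Type) (s : seq I) (P : pred I) (F : I -> R[i]) :
  Normc.normc (\sum_(i <- s | P i) F i) <= \sum_(i <- s | P i) Normc.normc (F i).
Proof.
elim/big_rec2 : _ => [|i x z _ h]; first by rewrite Normc.normc0.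
by apply: (le_trans (le_normcD _ _)); rewrite lerD2l.
Qed.

(** * Sums over the boxes [-n, n]^k of the integer lattice *)

Section Boxes.
Context {k : nat}.
Implicit Types (m : 'rV[int]_k).

Definition box_vec n (f : {ffun 'I_k -> 'I_(n.*2.+1)}) : 'rV[int]_k :=
  \row_i ((f i : nat)%:Z - n%:Z).

Definition box n : seq 'rV[int]_k := [seq box_vec f | f <- enum {ffun 'I_k -> 'I_(n.*2.+1)}].

Lemma box_vec_inj n : injective (@box_vec n).
Proof.
move=> f g /rowP h; apply/ffunP => i; apply: val_inj => /=.
have := h i; rewrite !mxE => /addIr. by case.
Qed.

Lemma uniq_box n : uniq (box n).
Proof. by rewrite map_inj_uniq ?enum_uniq//; exact: box_vec_inj. Qed.

Lemma mem_box n m : (m \in box n) = [forall i, (`|m 0%R i| <= n)%N].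
Proof.
apply/mapP/forallP => [[f _ ->] i|h].
  by rewrite mxE; move: (nat_of_ord (f i)) (ltn_ord (f i)) => j; rewrite -addnn; lia.
exists [ffun i => inord (absz (m 0 i + n%:Z))]; first by rewrite mem_enum.
apply/rowP => i; rewrite !mxE ffunE; have := h i; move: (m 0 i) => x hx.
by rewrite inordK ?ltnS -?addnn; lia.
Qed.

Definition box_sum (V : nmodType) (F : 'rV[int]_k -> V) n : V := \sum_(m <- box n) F m.

(** A box is a product, so a sum of products of functions of the coordinates is a
    product of one-dimensional sums. *)
Lemma box_sum_prod (A : comNzRingType) (G : 'I_k -> int -> A) n :
  box_sum (fun m => \prod_i G i (m 0 i)) n = \prod_i zsum (G i) n.
Proof.
rewrite /zsum bigA_distr_bigA /box_sum /box big_map big_enum /=.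
by apply: eq_bigr => f _; apply: eq_bigr => i _; rewrite mxE.
Qed.

Lemma box_sumB n n' (V : zmodType) (F : 'rV[int]_k -> V) : (n <= n')%N ->
  box_sum F n' - box_sum F n = \sum_(m <- box n' | m \notin box n) F m.
Proof.
move=> nn'; rewrite /box_sum (bigID (fun m => m \in box n)) /=.
rewrite -[X in X + _ - _]big_filter (perm_big (box n)) /=; first by rewrite addrC addKr.
apply: uniq_perm; rewrite ?filter_uniq ?uniq_box// => m.
rewrite mem_filter !mem_box andb_idr// => /forallP h; apply/forallP => i.
exact: leq_trans (h i) nn'.
Qed.

(** A summable weight on the lattice that factors over the coordinates. *)
Definition bweight (a : 'rV[R]_k) m : R := \prod_i zweight (a 0 i) (m 0 i).

Lemma bweight_gt0 a m : 0 < bweight a m.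
Proof. by apply: prodr_gt0 => i _; exact: zweight_gt0. Qed.

Lemma bweight_bound a n : box_sum (bweight a) n <= \prod_i (10 * (1 + a 0 i ^+ 2)).
Proof.
rewrite /bweight (box_sum_prod (fun i => zweight (a 0 i))); apply: ler_prod => i _.
rewrite zweight_bound andbT; apply: sumr_ge0 => j _; exact/ltW/zweight_gt0.
Qed.

Lemma box_sum_norm a C (F : 'rV[int]_k -> R[i]) n :
  (forall m, Normc.normc (F m) <= C * bweight a m) ->
  Normc.normc (box_sum F n) <= C * \prod_i (10 * (1 + a 0 i ^+ 2)).
Proof.
move=> h; apply: (le_trans (normc_sum _ _ _)).
apply: (@le_trans _ _ (\sum_(m <- box n) C * bweight a m)).
  by apply: ler_sum => m _; exact: h.
rewrite -mulr_sumr; apply: ler_wpM2l; last exact: bweight_bound.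
have := h 0; rewrite -(pmulr_lge0 _ (bweight_gt0 a 0)); apply: le_trans.
by case: (F 0) => x y; exact: sqrtr_ge0.
Qed.

Lemma box_sum_cvgn a C (F : 'rV[int]_k -> R) :
  (forall m, `|F m| <= C * bweight a m) -> cvgn (box_sum F).
Proof.
move=> h; apply: (@dominated_cvgn _ _ (fun n => C * box_sum (bweight a) n)
    (C * \prod_i (10 * (1 + a 0 i ^+ 2)))).
  move=> n; rewrite -mulrBr !box_sumB// mulr_sumr.
  by apply: (le_trans (ler_norm_sum _ _ _)); apply: ler_sum => m _; exact: h.
move=> n; apply: ler_wpM2l; last exact: bweight_bound.
by have := h 0; rewrite -(pmulr_lge0 _ (bweight_gt0 a 0)); exact: le_trans.
Qed.

Lemma box_sum_ccvg a C (F : 'rV[int]_k -> R[i]) :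
  (forall m, Normc.normc (F m) <= C * bweight a m) -> ccvg (box_sum F) (clim (box_sum F)).
Proof.
move=> h; rewrite /clim /box_sum; split => /=.
  under eq_fun do rewrite cRe_sum.
  apply: (@box_sum_cvgn a C) => m; exact: le_trans (norm_Re_le_normc _) (h m).
under eq_fun do rewrite cIm_sum.
apply: (@box_sum_cvgn a C) => m; exact: le_trans (norm_Im_le_normc _) (h m).
Qed.

Lemma box_sum_finite (F : 'rV[int]_k -> R[i]) N : (forall m, m \notin box N -> F m = 0) ->
  forall n, (N <= n)%N -> box_sum F n = \sum_(m \in [set: 'rV[int]_k]) F m.
Proof.
move=> h n Nn; rewrite (@fsbigE _ _ _ _ setT (box n)) ?uniq_box//=.
  by rewrite /box_sum; apply: eq_bigl => m; rewrite in_setT.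
move=> m _ mn; apply: h; apply: contra mn; rewrite !mem_box => /forallP h.
apply/forallP => i; exact: leq_trans (h i) Nn.
Qed.

End Boxes.
End ComplexLimits.

(** * Theta series of the lattice Z^k *)

Section ThetaK.
Context {R : realType}.
Implicit Types (a b c x : R).

Lemma rcM x y : (x * y)%:C = x%:C * y%:C :> R[i].
Proof. exact: rmorphM. Qed.

Lemma cReZ x (z : R[i]) : complex.Re (x%:C * z) = x * complex.Re z.
Proof. by rewrite cReM /= mul0r subr0. Qed.
Lemma cImZ x (z : R[i]) : complex.Im (x%:C * z) = x * complex.Im z.
Proof. by rewrite cImM /= mul0r addr0. Qed.

Lemma eqfun_cvgn (u v : nat -> R) (l : R) : u =1 v -> u @ \oo --> l -> v @ \oo --> l.
Proof. by move=> /funext ->. Qed.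

Lemma theta_line c a b : 2 <= c -> exists l : R[i],
  ccvg (zsum (fun n : int => (Num.sqrt (pi / c) * gaussian (pi ^+ 2 / c) (n%:~R + a))%:C
      * cis (2 * pi * (n%:~R * b)))) l /\
  ccvg (zsum (fun n : int => (gaussian c (n%:~R + b))%:C * cis (- (2 * pi * (a * (n%:~R + b)))))) l.
Proof.
move=> c2.
have [l1 [h1 h1']] := @poisson_gaussian R c a b 0 c2.
have [l2 [h2 h2']] := @poisson_gaussian R c a b (pi / 2) c2.
exists (l1 +i* l2); split; split => /=; rewrite /zsum.
- under eq_fun do rewrite cRe_sum; apply: eqfun_cvgn h1' => n; apply: eq_bigr => i _; rewrite cReZ /= subr0.
  by rewrite [in RHS]mulrA.
- under eq_fun do rewrite cIm_sum; apply: eqfun_cvgn h2' => n; apply: eq_bigr => i _; rewrite cImZ /= cosBpihalf.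
  by rewrite [in RHS]mulrA.
- under eq_fun do rewrite cRe_sum; apply: eqfun_cvgn h1 => n; apply: eq_bigr => i _; rewrite cReZ /= cosN /modulated_gaussian addr0.
  by rewrite [b + _]addrC !mulrA.
under eq_fun do rewrite cIm_sum; apply: eqfun_cvgn h2 => n; apply: eq_bigr => i _; rewrite cImZ /= sinN /modulated_gaussian cosDpihalf.
by rewrite [b + _]addrC !mulrA.
Qed.

Section K.
Context {k : nat}.
Implicit Types (u v w : 'rV[R]_k) (m : 'rV[int]_k).

Lemma dotv_ge0 u : 0 <= dotv u u.
Proof. by apply: sumr_ge0 => i _; rewrite -expr2 sqr_ge0. Qed.

Lemma enorm_sqr u : enorm u ^+ 2 = \sum_i u 0 i ^+ 2.
Proof. by rewrite sqr_sqrtr ?dotv_ge0//; apply: eq_bigr => i _; rewrite expr2. Qed.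

Lemma enorm_ge0 u : 0 <= enorm u.
Proof. exact: sqrtr_ge0. Qed.

(** This makes the Gaussian sum over the lattice a product of one-dimensional ones. *)
Lemma gaussian_enorm c u : gaussian c (enorm u) = \prod_i gaussian c (u 0 i).
Proof.
rewrite /gaussian enorm_sqr mulr_sumr expR_sum; apply: eq_bigr => i _ //.
Qed.

Lemma theta_lattice c (eta xi : 'rV[R]_k) : 2 <= c -> exists l : R[i],
  ccvg (box_sum (fun m => cis (2 * pi * dotv (zvec R m) xi) *
    (Num.sqrt (pi / c) ^+ k * gaussian (pi ^+ 2 / c) (enorm (zvec R m + eta)))%:C)) l /\
  ccvg (box_sum (fun m => cis (- (2 * pi * dotv eta xi)) *
    (cis (- (2 * pi * dotv (zvec R m) eta)) * (gaussian c (enorm (zvec R m + xi)))%:C))) l.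
Proof.
move=> c2.
have [l hl] : {l : 'I_k -> R[i] | forall i,
  ccvg (zsum (fun n : int => (Num.sqrt (pi / c) * gaussian (pi ^+ 2 / c) (n%:~R + eta 0 i))%:C
      * cis (2 * pi * (n%:~R * xi 0 i)))) (l i) /\
  ccvg (zsum (fun n : int => (gaussian c (n%:~R + xi 0 i))%:C *
      cis (- (2 * pi * (eta 0 i * (n%:~R + xi 0 i)))))) (l i)}.
  exists (fun i => projT1 (cid (theta_line (eta 0 i) (xi 0 i) c2))) => i.
  by case: cid.
exists (\prod_i l i); split.
- have := ccvg_prod (index_enum 'I_k) (fun i => (hl i).1).
  congr ccvg; apply/funext => n; rewrite -box_sum_prod; apply: eq_bigr => m _.
  rewrite big_split /= mulrC; congr (_ * _).
    rewrite -cis_sum; congr cis; rewrite mulr_sumr; apply: eq_bigr => i _.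
    by rewrite mxE.
  rewrite gaussian_enorm -rmorph_prod; congr (_%:C); rewrite big_split /= prodr_const card_ord.
  by congr (_ * _); apply: eq_bigr => i _; rewrite !mxE.
- have := ccvg_prod (index_enum 'I_k) (fun i => (hl i).2).
  congr ccvg; apply/funext => n; rewrite -box_sum_prod; apply: eq_bigr => m _.
  rewrite big_split /= mulrC mulrA; congr (_ * _).
    rewrite -cis_sum -cisD; congr cis; rewrite /dotv !mulr_sumr -!sumrN -big_split /=.
    by apply: eq_bigr => i _; rewrite mxE; ring.
  rewrite gaussian_enorm -rmorph_prod; congr (_%:C).
  by apply: eq_bigr => i _; rewrite !mxE.
Qed.

End K.
End ThetaK.

(** * Profiles: odd functions as x times functions of x^2 *)

Section Profiles.
Context {R : realType}.
Implicit Types (b c x t r e : R) (q p : nat -> R -> R).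

(** If q_0(x) = phi(x^2) then q_i(x) = phi^(i)(x^2): the derivative with respect to
    x^2, written without division by x. *)
Definition profile q := forall i, has_deriv (q i) (fun x => 2 * x * q i.+1 x).

(** The weight e^(-2 x^2) tolerates every power of x that arises on integrating by
    parts, see [gaussian2_bound]. *)
Definition profile_bound K e q := forall i x, (i <= K)%N -> `|q i x| <= e * gaussian 2 x.

Lemma profileB q p : profile q -> profile p -> profile (fun i x => q i x - p i x).
Proof.
move=> hq hp i; apply: (has_deriv_eq (has_derivB (hq i) (hp i))) => x.
by rewrite mulrBr.
Qed.

Lemma profile_gdom K e q n i : profile q -> profile_bound K e q -> (i <= K)%N ->
  gauss_dominated (fun x => x ^+ n * q i x).
Proof.
move=> hq hb iK; apply: (@gdom_Xmul _ _ _ e); first exact: has_deriv_continuous (hq i).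
by move=> x; exact: hb.
Qed.

Fixpoint decay_const (n a : nat) : R :=
  if n is n'.+1 then a%:R * decay_const n' a.-1 + 2 * decay_const n' a.+1
  else (1 + a`!%:R) * Num.sqrt pi.

Lemma cosineD f g t : gauss_dominated f -> gauss_dominated g ->
  cosine_transform (fun x => f x + g x) t = cosine_transform f t + cosine_transform g t.
Proof.
move=> hf hg; rewrite /cosine_transform -integD; [|exact: gdom_cos|exact: gdom_cos].
by congr integ; apply/funext => x; rewrite mulrDl.
Qed.

Lemma sineD f g t : gauss_dominated f -> gauss_dominated g ->
  sine_transform (fun x => f x + g x) t = sine_transform f t + sine_transform g t.
Proof.
move=> hf hg; rewrite /sine_transform -integD; [|exact: gdom_sin|exact: gdom_sin].
by congr integ; apply/funext => x; rewrite mulrDl.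
Qed.

Lemma cosineZ c f t : gauss_dominated f -> cosine_transform (fun x => c * f x) t = c * cosine_transform f t.
Proof.
move=> hf; rewrite /cosine_transform -integZ; last exact: gdom_cos.
by congr integ; apply/funext => x; rewrite mulrA.
Qed.

Lemma sineZ c f t : gauss_dominated f -> sine_transform (fun x => c * f x) t = c * sine_transform f t.
Proof.
move=> hf; rewrite /sine_transform -integZ; last exact: gdom_sin.
by congr integ; apply/funext => x; rewrite mulrA.
Qed.

(** An integration by parts gains a factor 1/t and replaces x^a q_i by
    a x^(a-1) q_i + 2 x^(a+1) q_(i+1), of the same kind. *)
Lemma trig_decay q K e n a i t : profile q -> profile_bound K e q -> (i + n <= K)%N ->
  `|t| ^+ n * `|cosine_transform (fun x => x ^+ a * q i x) t| <= decay_const n a * e /\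
  `|t| ^+ n * `|sine_transform (fun x => x ^+ a * q i x) t| <= decay_const n a * e.
Proof.
move=> hq hb; elim: n a i => [|n IH] a i inK.
  rewrite addn0 in inK; rewrite !expr0 !mul1r /=.
  have bd (T : R -> R) : continuous T -> (forall x, `|T x| <= 1) ->
      `|integ (fun x => x ^+ a * q i x * T x)| <= (1 + a`!%:R) * Num.sqrt pi * e.
    move=> cT hT; rewrite [leRHS]mulrC [leRHS]mulrA; apply: integ_bound.
      by apply: continuous_mul => //; case: (profile_gdom a hq hb inK).
    move=> x; rewrite !normrM normrX.
    apply: (@le_trans _ _ (`|x| ^+ a * (e * gaussian 2 x))).
      rewrite -[leRHS]mulr1; apply: ler_pM; rewrite ?mulr_ge0 ?exprn_ge0//.
      by rewrite ler_wpM2l ?exprn_ge0// hb.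
    have e0 : 0 <= e.
      have := hb i 0 inK; rewrite -(pmulr_lge0 _ (gaussian_gt0 2 (0:R))); exact: le_trans.
    by rewrite mulrCA -[leRHS]mulrA ler_wpM2l// gaussian2_bound.
  split; apply: bd => x; rewrite ?cos_max ?sin_max//.
    exact: (has_deriv_continuous (@has_deriv_cosm R t)).
  exact: (has_deriv_continuous (@has_deriv_sinm R t)).
have iK : (i <= K)%N by lia.
have i1K : (i.+1 <= K)%N by lia.
have g1 := profile_gdom a.-1 hq hb iK.
have g2 := profile_gdom a.+1 hq hb i1K.
have g0 := profile_gdom a hq hb iK.
have hd : has_deriv (fun x => x ^+ a * q i x)
    (fun x => a%:R * (x ^+ a.-1 * q i x) + 2 * (x ^+ a.+1 * q i.+1 x)).
  apply: (has_deriv_eq (has_derivM (@has_derivX R a) (hq i))) => x.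
  by rewrite exprS; ring.
have gd := gdomD (gdomZ a%:R g1) (gdomZ 2 g2).
have E1 := sine_ibp t hd g0 gd; have E2 := cosine_ibp t hd g0 gd.
rewrite sineD ?sineZ// in E1; [|exact: gdomZ|exact: gdomZ].
rewrite cosineD ?cosineZ// in E2; [|exact: gdomZ|exact: gdomZ].
have [IHc1 IHs1] := IH a.-1 i (ltac:(lia)).
have [IHc2 IHs2] := IH a.+1 i.+1 (ltac:(lia)).
have tn : 0 <= `|t| ^+ n by rewrite exprn_ge0.
have fin (A B : R) : `|t| ^+ n * `|A| <= decay_const n a.-1 * e ->
    `|t| ^+ n * `|B| <= decay_const n a.+1 * e ->
    `|t| ^+ n * `|a%:R * A + 2 * B| <= decay_const n.+1 a * e.
  move=> hA hB; rewrite /= [leRHS]mulrDl -!mulrA.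
  apply: (@le_trans _ _ (a%:R * (`|t| ^+ n * `|A|) + 2 * (`|t| ^+ n * `|B|))).
    rewrite (mulrCA a%:R) (mulrCA 2) -mulrDr ler_wpM2l//.
    by apply: (le_trans (ler_normD _ _)); rewrite !normrM !normr_nat.
  by apply: lerD; rewrite ler_wpM2l.
have shift (X : R) : `|t| ^+ n.+1 * `|X| = `|t| ^+ n * `|t * X|.
  by rewrite normrM mulrA -exprSr.
split; rewrite shift; last by rewrite -E2; exact: fin.
by rewrite -[`|t * _|]normrN -E1; exact: fin.
Qed.

Lemma expr1D_le k x : 0 <= x -> (1 + x) ^+ k <= 2 ^+ k * (1 + x ^+ k).
Proof.
move=> x0; have [x1|x1] := leP x 1.
  apply: (@le_trans _ _ (2 ^+ k)).
    by apply: lerXn2r; rewrite ?nnegrE//; lra.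
  by rewrite ler_peMr ?exprn_ge0// lerDl exprn_ge0.
apply: (@le_trans _ _ ((2 * x) ^+ k)).
  by apply: lerXn2r; rewrite ?nnegrE; lra.
by rewrite exprMn ler_wpM2l ?exprn_ge0// lerDr.
Qed.

Lemma sine_decay k : exists2 C : R, 0 <= C & forall q e r, profile q ->
  profile_bound (2 * k) e q -> 0 <= r ->
  `|sine_transform (fun x => x * q 0%N x) (2 * pi * r)| <= C * e * ((1 + r ^+ 2) ^+ k)^-1.
Proof.
have dc n a : 0 <= decay_const n a.
  elim: n a => [|n IH] a /=; first by rewrite mulr_ge0 ?sqrtr_ge0// addr_ge0.
  by rewrite addr_ge0// mulr_ge0.
exists (2 ^+ k * (decay_const 0 1 + decay_const (2 * k) 1)).
  by rewrite mulr_ge0 ?exprn_ge0// addr_ge0.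
move=> q e r hq hb r0.
have r2 : 0 <= r ^+ 2 by exact: sqr_ge0.
rewrite ler_pdivlMr; last by rewrite exprn_gt0// ltr_wpDr.
have [_ H0] := @trig_decay q (2 * k) e 0 1 0 (2 * pi * r) hq hb (leq0n _).
have [_ H1] := @trig_decay q (2 * k) e (2 * k) 1 0 (2 * pi * r) hq hb (leqnn _).
rewrite (_ : (fun x => x * q 0%N x) = (fun x => x ^+ 1 * q 0%N x)); last first.
  by apply/funext => x; rewrite expr1.
set S := `|sine_transform _ _| in H0 H1 *.
have S0 : 0 <= S by exact: normr_ge0.
rewrite expr0 mul1r in H0.
apply: (@le_trans _ _ (S * (2 ^+ k * (1 + (r ^+ 2) ^+ k)))).
  by rewrite ler_wpM2l// expr1D_le.
rewrite mulrCA -!mulrA ler_wpM2l ?exprn_ge0// mulrDr mulr1 mulrDl lerD//.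
apply: le_trans H1; rewrite mulrC ler_wpM2r// -exprM.
apply: lerXn2r; rewrite ?nnegrE//.
rewrite ger0_norm ?mulr_ge0 ?pi_ge0// ler_peMl//.
have := @pihalf_ge1 R; lra.
Qed.

Lemma gaussian2_weight k x : gaussian 2 x <= 2 ^+ k * (2 + (2 * k)`!%:R) * ((1 + x ^+ 2) ^+ k)^-1.
Proof.
have x2 := sqr_ge0 x.
rewrite ler_pdivlMr; last by rewrite exprn_gt0// ltr_wpDr.
have g0 : 0 <= gaussian 2 x by exact/ltW/gaussian_gt0.
have g1 : gaussian 2 x <= 1.
  by rewrite /gaussian -expR0 ler_expR mulNr oppr_le0 mulr_ge0.
apply: (@le_trans _ _ (gaussian 2 x * (2 ^+ k * (1 + (x ^+ 2) ^+ k)))).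
  by rewrite ler_wpM2l// expr1D_le.
rewrite mulrCA ler_wpM2l ?exprn_ge0// mulrDr mulr1.
have := gaussian2_bound (2 * k) x; rewrite exprM real_normK ?num_real// => H.
have : gauss_fun x <= 1 :> R by exact: gauss_fun_le1.
have : 0 <= gauss_fun x :> R by exact: gauss_fun_ge0.
have : 0 <= (2 * k)`!%:R :> R by [].
by move: H; rewrite mulrC; nra.
Qed.

Section Lattice.
Context {k : nat}.
Implicit Types (u : 'rV[R]_k) (m : 'rV[int]_k).

(** Each of the k factors 1 + |m + u|^2 dominates one of the factors
    1 + (m_i + u_i)^2. *)
Lemma weight_bweight u m : ((1 + enorm (zvec R m + u) ^+ 2) ^+ k)^-1 <= bweight u m.
Proof.
rewrite /bweight /zweight.
have -> : \prod_i (1 + ((m 0 i)%:~R + u 0 i) ^+ 2)^-1 =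
   (\prod_i (1 + ((m 0 i)%:~R + u 0 i) ^+ 2))^-1.
  by rewrite prodfV.
rewrite lef_pV2 ?posrE; last 2 first.
- by rewrite exprn_gt0// ltr_wpDr// sqr_ge0.
- by apply: prodr_gt0 => i _; rewrite ltr_wpDr// sqr_ge0.
have -> : (1 + enorm (zvec R m + u) ^+ 2) ^+ k =
    \prod_(i < k) (1 + enorm (zvec R m + u) ^+ 2).
  by rewrite prodr_const card_ord.
apply: ler_prod => i _.
apply/andP; split; first by rewrite addr_ge0// sqr_ge0.
rewrite lerD2l enorm_sqr (bigD1 i) //= !mxE lerDl.
by apply: sumr_ge0 => j _; exact: sqr_ge0.
Qed.

Lemma coord_le_enorm u i : `|u 0 i| <= enorm u.
Proof.
rewrite -(@ler_pXn2r _ 2) ?nnegrE ?enorm_ge0// real_normK ?num_real// enorm_sqr.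
by rewrite (bigD1 i) //= lerDl; apply: sumr_ge0 => j _; exact: sqr_ge0.
Qed.

(** Some coordinate of u is not an integer, and its distance to the integers is a
    lower bound. *)
Lemma enorm_gap u : (forall m, u <> zvec R m) ->
  exists2 d : R, 0 < d & forall m, d <= enorm (zvec R m + u).
Proof.
move=> hu.
have [i hi] : exists i, u 0 i != (Num.floor (u 0 i))%:~R.
  apply/existsP; rewrite -negb_forall; apply/negP => /forallP h.
  apply: (hu (\row_i Num.floor (u 0 i))); apply/rowP => i.
  by rewrite !mxE; exact/eqP.
set x := u 0 i in hi *; set f := Num.floor x in hi *.
have f1 : f%:~R <= x by exact: floor_le_tmp.
have f2 : x < f%:~R + 1 by rewrite -intrD1 floorD1_gt.
have f3 : 0 < x - f%:~R by rewrite subr_gt0 lt_def hi.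
exists (Num.min (x - f%:~R) (f%:~R + 1 - x)); first by rewrite lt_min f3 subr_gt0.
move=> m; apply: le_trans (coord_le_enorm _ i); rewrite !mxE -/x.
have [le|lt] := leP 0 (m 0 i + f).
  rewrite ge_min; apply/orP; left; apply: le_trans (ler_norm _).
  have : 0 <= (m 0 i + f)%:~R :> R by rewrite ler0z.
  by rewrite intrD; lra.
rewrite ge_min; apply/orP; right; rewrite -normrN; apply: le_trans (ler_norm _).
have : (m 0 i + f + 1)%:~R <= 0 :> R by rewrite lerz0; lia.
by rewrite !intrD; lra.
Qed.

End Lattice.
End Profiles.

(** * The summation formula for a profile *)

Section Summation.
Context {R : realType} {k : nat}.
Variables (eta xi : 'rV[R]_k) (N : nat).
Implicit Types (q p : nat -> R -> R) (m : 'rV[int]_k).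

(** In dimension k = 2N + 3 the radial functions S(|y|)/|y|, with S(r) the integral
    of x q_0(x) sin(2 pi r x), and (- 1/pi)^N q_N(|y|) are Fourier transforms of each
    other; [lhs_term] and [rhs_term] are the terms of the corresponding Poisson
    summation formula. *)
Definition lhs_term q m : R[i] :=
  let r := enorm (zvec R m + eta) in
  cis (2 * pi * dotv (zvec R m) xi) * (sine_transform (fun x => x * q 0%N x) (2 * pi * r) / r)%:C.

Definition rhs_term q m : R[i] :=
  cis (- (2 * pi * dotv eta xi)) * (cis (- (2 * pi * dotv (zvec R m) eta)) *
    ((- pi^-1) ^+ N * q N (enorm (zvec R m + xi)))%:C).

Lemma normc_real (x : R) : Normc.normc x%:C = `|x|.
Proof. by rewrite /= expr0n /= addr0 sqrtr_sqr. Qed.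

Lemma lhs_term_bound (d : R) : 0 < d -> (forall m, d <= enorm (zvec R m + eta)) ->
  exists C : R, forall q e, profile q -> profile_bound (2 * k) e q ->
    forall m, Normc.normc (lhs_term q m) <= C * e * bweight eta m.
Proof.
move=> d0 hd; have [C C0 hC] := @sine_decay R k.
exists (C / d) => q e hq hb m.
have r0 : 0 < enorm (zvec R m + eta) by exact: lt_le_trans d0 (hd m).
rewrite /lhs_term Normc.normcM normc_cis mul1r normc_real normrM normfV.
rewrite (gtr0_norm r0) ler_pdivrMr//.
apply: (le_trans (hC q e _ hq hb (ltW r0))).
have w := weight_bweight eta m.
have e0 : 0 <= e.
  have := hb 0%N 0 (leq0n _); rewrite -(pmulr_lge0 _ (gaussian_gt0 2 (0:R))); exact: le_trans.
have Ce : 0 <= C * e by rewrite mulr_ge0.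
apply: (@le_trans _ _ (C * e * bweight eta m)); first exact: ler_wpM2l.
have B0 := ltW (bweight_gt0 eta m).
rewrite (_ : C / d * e * _ * _ = C * e * bweight eta m * (enorm (zvec R m + eta) / d)).
  by rewrite ler_peMr ?(mulr_ge0 Ce B0)// ler_pdivlMr// mul1r.
by field; rewrite gt_eqF.
Qed.

Lemma rhs_term_bound : (N <= 2 * k)%N ->
  exists C : R, forall q e, profile_bound (2 * k) e q ->
    forall m, Normc.normc (rhs_term q m) <= C * e * bweight xi m.
Proof.
move=> Nk; exists (pi^-1 ^+ N * (2 ^+ k * (2 + (2 * k)`!%:R))) => q e hb m.
rewrite /rhs_term !Normc.normcM !normc_cis !mul1r normc_real normrM normrX normrN.
have p0 : 0 <= pi^-1 :> R by rewrite invr_ge0 pi_ge0.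
rewrite (ger0_norm p0) -!mulrA ler_wpM2l ?exprn_ge0//.
apply: (le_trans (hb _ _ Nk)).
have e0 : 0 <= e.
  have := hb 0%N 0 (leq0n _); rewrite -(pmulr_lge0 _ (gaussian_gt0 2 (0:R))); exact: le_trans.
rewrite [leRHS](_ : _ = e * (2 ^+ k * (2 + (2 * k)`!%:R) * bweight xi m)); last by ring.
rewrite ler_wpM2l//; apply: (le_trans (gaussian2_weight k _)).
by rewrite ler_wpM2l ?weight_bweight// mulr_ge0 ?exprn_ge0// addr_ge0.
Qed.

Definition summation_formula q := exists l : R[i],
  ccvg (box_sum (lhs_term q)) l /\ ccvg (box_sum (rhs_term q)) l.

Definition gaussian_profile (c : R) i x : R := (- c) ^+ i * gaussian c x.

Lemma gaussian_profileP c : profile (gaussian_profile c).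
Proof.
move=> i; apply: (has_deriv_eq (has_derivZ ((- c) ^+ i) (@has_deriv_gaussian R c))) => x.
by rewrite /gaussian_profile exprS; ring.
Qed.

(** On a Gaussian both sides are theta series, and the formula is [theta_lattice]
    multiplied by (c/pi)^N. *)
Lemma summation_gaussian c : 2 <= c -> k = (2 * N + 3)%N ->
  (forall m, 0 < enorm (zvec R m + eta)) -> summation_formula (gaussian_profile c).
Proof.
move=> c2 kN r0; have [l [h1 h2]] := theta_lattice eta xi c2.
have c0 : c != 0 by rewrite gt_eqF//; lra.
have p0 : pi != 0 :> R by rewrite gt_eqF// pi_gt0.
exists (((c / pi) ^+ N)%:C * l); split.
- have := ccvgMl ((c / pi) ^+ N)%:C h1; congr ccvg; apply/funext => n.
  rewrite /box_sum mulr_sumr; apply: eq_bigr => m _.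
  rewrite /lhs_term mulrCA; congr (_ * _); rewrite -rcM; congr (_%:C).
  rewrite (_ : (fun x => x * gaussian_profile c 0 x) = (fun x => x * gaussian c x)); last first.
    by apply/funext => x; rewrite /gaussian_profile expr0 mul1r.
  rewrite sine_Xgaussian// cosine_gaussian//; move: (r0 m); set r := enorm _ => rm.
  have -> : gaussian (4 * c)^-1 (2 * pi * r) = gaussian (pi ^+ 2 / c) r.
    by rewrite /gaussian; congr expR; move: (@pi R) => P; field.
  (* As k = 2N + 3, the factors pair up into (pi / c)^(N + 1) and one root remains. *)
  have -> : Num.sqrt (pi / c) ^+ k = (pi / c) ^+ N * (pi / c) * Num.sqrt (pi / c).
    rewrite kN exprD exprM sqr_sqrtr ?divr_ge0 ?pi_ge0//; last by lra.
    rewrite -mulrA; congr (_ * _); rewrite exprSr sqr_sqrtr// divr_ge0 ?pi_ge0//; lra.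
  rewrite mulrA !mulrA -exprMn.
  have -> : c / pi * (pi / c) = 1 by move: (@pi R) p0 => P P0; field; rewrite c0 P0.
  rewrite expr1n mul1r; move: (Num.sqrt _) (gaussian _ _) => s g.
  by move: (@pi R) => P; field; rewrite c0 gt_eqF.
- have := ccvgMl ((c / pi) ^+ N)%:C h2; congr ccvg; apply/funext => n.
  rewrite /box_sum mulr_sumr; apply: eq_bigr => m _.
  rewrite /rhs_term mulrCA; congr (_ * _); rewrite mulrCA; congr (_ * _).
  rewrite -rcM; congr (_%:C); rewrite /gaussian_profile mulrA -exprMn; congr (_ ^+ N * _).
  by rewrite mulrNN mulrC.
Qed.

Lemma summation_lincomb (n : nat) (a c : nat -> R) : (forall j, 2 <= c j) ->
  (forall j, summation_formula (gaussian_profile (c j))) ->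
  summation_formula (fun i x => \sum_(j < n) a j * gaussian_profile (c j) i x).
Proof.
move=> c2 h.
have [l hl] : {l : nat -> R[i] | forall j, ccvg (box_sum (lhs_term (gaussian_profile (c j)))) (l j) /\
   ccvg (box_sum (rhs_term (gaussian_profile (c j)))) (l j)}.
  by exists (fun j => projT1 (cid (h j))) => j; case: cid.
exists (\sum_(j < n) (a j)%:C * l j); split.
- have := ccvg_sum (index_enum 'I_n) (fun j : 'I_n => ccvgMl (a j)%:C (hl j).1).
  congr ccvg; apply/funext => M; rewrite /box_sum.
  under eq_bigr do rewrite mulr_sumr.
  rewrite exchange_big; apply: eq_bigr => m _ /=.
  under eq_bigr do rewrite /lhs_term mulrCA.
  rewrite -mulr_sumr /lhs_term; congr (_ * _).
  under eq_bigr do rewrite -rcM.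
  rewrite -rmorph_sum; congr (_%:C).
  under eq_bigr do rewrite mulrA.
  rewrite -mulr_suml; congr (_ / _).
  have g1 (j : 'I_n) : gauss_dominated (fun x => x * gaussian_profile (c j) 0 x).
    have := gdom_Xgaussian 1 (c2 j); congr gauss_dominated; apply/funext => x.
    by rewrite expr1 /gaussian_profile expr0 mul1r.
  transitivity (sine_transform (fun x => \sum_(j < n) a j * (x * gaussian_profile (c j) 0 x)) (2 * pi * enorm (zvec R m + eta))).
    rewrite /sine_transform -[RHS]/(integ _).
    rewrite (_ : (fun x => (\sum_(j < n) a j * (x * gaussian_profile (c j) 0 x)) * sin (2 * pi * enorm (zvec R m + eta) * x)) =
       (fun x => \sum_(j < n) a j * (x * gaussian_profile (c j) 0 x * sin (2 * pi * enorm (zvec R m + eta) * x)))); last first.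
      by apply/funext => x; rewrite mulr_suml; apply: eq_bigr => j _; rewrite -!mulrA.
    rewrite integ_sum; last by move=> j; exact/gdomZ/gdom_sin.
    by apply: eq_bigr => j _; rewrite integZ//; exact: gdom_sin.
  congr sine_transform; apply/funext => x; rewrite mulr_sumr; apply: eq_bigr => j _.
  by rewrite mulrCA.
- have := ccvg_sum (index_enum 'I_n) (fun j : 'I_n => ccvgMl (a j)%:C (hl j).2).
  congr ccvg; apply/funext => M; rewrite /box_sum.
  under eq_bigr do rewrite mulr_sumr.
  rewrite exchange_big; apply: eq_bigr => m _ /=.
  transitivity (\sum_(j < n) cis (- (2 * pi * dotv eta xi)) *
    (cis (- (2 * pi * dotv (zvec R m) eta)) *
     (a j * ((- pi^-1) ^+ N * gaussian_profile (c j) N (enorm (zvec R m + xi))))%:C)).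
    by apply: eq_bigr => j _; rewrite rcM mulrCA; congr (_ * _); rewrite mulrCA.
  rewrite -mulr_sumr -mulr_sumr /rhs_term; congr (_ * (_ * _)).
  rewrite -rmorph_sum; congr (_%:C).
  by rewrite mulr_sumr; apply: eq_bigr => j _; rewrite mulrCA.
Qed.

(** Both sides of the formula are linear in the profile and bounded by a constant
    times any profile bound, so the formula passes to limits. *)
Lemma summation_closure q M : (N <= 2 * k)%N -> (forall m, eta <> zvec R m) ->
  profile q -> profile_bound (2 * k) M q ->
  (forall e, 0 < e -> exists p, [/\ profile p, summation_formula p &
     profile_bound (2 * k) e (fun i x => q i x - p i x)]) ->
  summation_formula q.
Proof.
move=> Nk heta hq hM app.
have [d d0 hd] := enorm_gap heta.
have [C1 hC1] := lhs_term_bound d0 hd.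
have [C2 hC2] := rhs_term_bound Nk.
have cv1 := box_sum_ccvg (hC1 q M hq hM).
have cv2 := box_sum_ccvg (hC2 q M hM).
exists (clim (box_sum (lhs_term q))); split=> //.
suff -> : clim (box_sum (lhs_term q)) = clim (box_sum (rhs_term q)) by [].
set z1 := clim _ in cv1 *; set z2 := clim _ in cv2 *.
pose P1 := \prod_i (10 * (1 + eta 0 i ^+ 2)); pose P2 := \prod_i (10 * (1 + xi 0 i ^+ 2)).
have key e : 0 < e -> Normc.normc (z1 - z2) <= 2 * (C1 * e * P1) + 2 * (C2 * e * P2).
  move=> e0; have [p [hp [l [l1 l2]] hb]] := app e e0.
  have hqp := profileB hq hp.
  have E1 : ccvg (box_sum (lhs_term (fun i x => q i x - p i x))) (z1 - l).
    have := ccvgD cv1 (ccvgMl (-1) l1); rewrite mulN1r; congr ccvg; apply/funext => n.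
    rewrite mulN1r /box_sum -sumrB; apply: eq_bigr => m _.
    rewrite /lhs_term -mulrBr; congr (_ * _); rewrite -rmorphB -mulrBl; congr ((_ / _)%:C).
    have g1 := profile_gdom 1 hq hM (leq0n _).
    have g2 := profile_gdom 1 hqp hb (leq0n _).
    rewrite [X in _ = X](_ : _ = sine_transform (fun x => x ^+ 1 * (q 0%N x - p 0%N x)) (2 * pi * enorm (zvec R m + eta))); last first.
      by congr sine_transform; apply/funext => x; rewrite expr1.
    have -> : (fun x => x * q 0%N x) = (fun x => x * p 0%N x + x ^+ 1 * (q 0%N x - p 0%N x)).
      by apply/funext => x; rewrite expr1; ring.
    have g3 : gauss_dominated (fun x => x * p 0%N x).
      by have := gdomB g1 g2; congr gauss_dominated; apply/funext => x; rewrite expr1; ring.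
    by rewrite sineD// addrC addKr.
  have E2 : ccvg (box_sum (rhs_term (fun i x => q i x - p i x))) (z2 - l).
    have := ccvgD cv2 (ccvgMl (-1) l2); rewrite mulN1r; congr ccvg; apply/funext => n.
    rewrite mulN1r /box_sum -sumrB; apply: eq_bigr => m _.
    by rewrite /rhs_term -mulrBr -mulrBr -rmorphB -mulrBr.
  have B1 := ccvg_bound E1 (fun n => box_sum_norm n (hC1 _ e hqp hb)).
  have B2 := ccvg_bound E2 (fun n => box_sum_norm n (hC2 _ e hb)).
  have -> : z1 - z2 = (z1 - l) + - (z2 - l) by ring.
  by apply: (le_trans (le_normcD _ _)); rewrite normcN; exact: lerD.
apply/eqP; rewrite -subr_eq0; apply/eqP; apply: Normc.eq0_normc.
apply/eqP; rewrite eq_le; apply/andP; split; last first.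
  by case: (z1 - z2) => x y; exact: sqrtr_ge0.
apply/ler_addgt0Pl => dd dd0; rewrite addr0.
pose K := 2 * (C1 * P1) + 2 * (C2 * P2).
have K0 : 0 < `|K| + 1 by rewrite ltr_wpDl.
have e0 : 0 < dd / (`|K| + 1) by rewrite divr_gt0.
apply: (le_trans (key _ e0)); rewrite [leLHS](_ : _ = K * dd / (`|K| + 1)); last first.
  by rewrite /K; field; rewrite gt_eqF.
rewrite ler_pdivrMr//; have := ler_norm K; nra.
Qed.

End Summation.

(** * Dividing a smooth odd function by x *)

Section Division.
Context {R : realType}.
Implicit Types (x s B M : R) (H : nat -> R -> R) (f df : R -> R).
Local Notation mu := (@lebesgue_measure R).

(** H n is the n-th derivative of H 0. Global bounds hold for derivatives of test
    functions and survive the division, see [div_family_smooth]. *)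
Definition smooth_family H := (forall n, has_deriv (H n) (H n.+1)) /\
  (forall n, exists B, forall x, `|H n x| <= B).

(** The n-th derivative of (H 0 x - H 0 0) / x, in the form that Hadamard's lemma
    gives it, which is smooth at the origin as well. *)
Definition div_family H n x : R := \int[mu]_(s in `[0, 1]) (s ^+ n * H n.+1 (s * x)).

Lemma continuous_scale f x : continuous f -> continuous (fun s => f (s * x)).
Proof.
move=> cf s; apply: continuous_comp; last exact: cf.
by apply: cvgM; [exact: cvg_id|exact: cvg_cst].
Qed.

Lemma div_family_integrable H n x : smooth_family H ->
  mu.-integrable `[0, 1] (EFin \o (fun s => s ^+ n * H n.+1 (s * x))).
Proof.
move=> [hd _]; apply: continuous_itv_int; apply: continuous_mul.
  exact: continuousX.
apply: continuous_scale; exact: has_deriv_continuous (hd n.+1).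
Qed.

Lemma div_family_smooth H : smooth_family H -> smooth_family (div_family H).
Proof.
move=> sH; have [hd hb] := sH; split=> n.
- have [B hB] := hb n.+2.
  apply: (@has_deriv_integral _ `[0%R, 1%R]%classic
    (fun x s => s ^+ n * H n.+1 (s * x))
    (fun x s => s ^+ n.+1 * H n.+2 (s * x)) (fun=> B)) => //.
  + by move=> x; exact: div_family_integrable.
  + move=> s _; have h := has_derivZ (s ^+ n) (has_deriv_comp (hd n.+1)
      (has_derivZ s (@has_deriv_id R))).
    by apply: (has_deriv_eq h) => x; rewrite mulr1 exprSr mulrA.
  + by move=> s; apply: le_trans (hB 0).
  + by apply: continuous_itv_int => x; exact: cvg_cst.
  + move=> x s; rewrite /= in_itv /= => /andP[s0 s1].
    rewrite normrM -[leRHS]mul1r ler_pM//.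
    by rewrite normrX ger0_norm// exprn_ile1.
have [B hB] := hb n.+1; exists B => x.
have i1 := div_family_integrable n x sH.
apply: (le_trans (le_normr_Rintegral _ i1)) => //.
have -> : B = \int[mu]_(s in `[0, 1]) (cst B s).
  rewrite (@integ_itv _ (fun s => B * s))//; first by rewrite mulr0 mulr1 subr0.
    by have := has_derivZ B (@has_deriv_id R); rewrite mulr1.
  by move=> ?; exact: cvg_cst.
apply: le_Rintegral => //.
- exact: integrable_abse i1.
- by apply: continuous_itv_int => ?; exact: cvg_cst.
move=> s; rewrite /= in_itv /= => /andP[s0 s1].
rewrite normrM -[leRHS]mul1r ler_pM//.
by rewrite normrX ger0_norm// exprn_ile1.
Qed.

Lemma mul_div_family H x : smooth_family H -> x * div_family H 0 x = H 0 x - H 0 0.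
Proof.
move=> sH; have [hd _] := sH.
rewrite /div_family -RintegralZl//; last exact: div_family_integrable.
have h : has_deriv (fun s => H 0 (s * x)) (fun s => x * (s ^+ 0 * H 1 (s * x))).
  have h := has_deriv_comp (hd 0) (has_derivM (@has_deriv_id R) (has_deriv_cst x)).
  by apply: (has_deriv_eq h) => s; rewrite mul1r mulr0 addr0 expr0 mul1r.
rewrite (integ_itv h)// ?mul1r ?mul0r//.
apply: continuous_mul; first by move=> ?; exact: cvg_cst.
apply: continuous_mul; first exact: continuousX.
apply: continuous_scale; exact: has_deriv_continuous (hd 1).
Qed.

Definition parity_family (b : bool) H := forall n x, H n (- x) = (-1) ^+ (n + b) * H n x.

Lemma div_family_parity H : parity_family true H -> smooth_family H ->
  parity_family false (div_family H).
Proof.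
move=> pH sH n x; rewrite /div_family -RintegralZl//; last exact: div_family_integrable.
apply: eq_Rintegral => s _; rewrite mulrN pH addn0 addn1 !exprS; ring.
Qed.

(** The derivative of an even function is odd, hence again divisible by x: half of
    it is the odd function with which the next step starts. *)
Fixpoint quot_family H i : nat -> R -> R :=
  if i is i'.+1 then fun n x => 2^-1 * div_family (quot_family H i') n.+1 x else H.

Lemma quot_family_smooth H i : smooth_family H -> parity_family true H ->
  smooth_family (quot_family H i) /\ parity_family true (quot_family H i).
Proof.
move=> sH pH; elim: i => [|i [IH1 IH2]] //=.
have [hd hb] := div_family_smooth IH1; have hp := div_family_parity IH2 IH1.
split; first split=> n.
- exact: has_derivZ (hd n.+1).
- have [B hB] := hb n.+1; exists (2^-1 * B) => x.
  by rewrite normrM ger0_norm ?invr_ge0// ler_wpM2l ?invr_ge0.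
by move=> n x; rewrite hp mulrCA addn0 addn1.
Qed.

(** The region M < |x| is open. *)
Lemma has_deriv_vanish f df M : has_deriv f df -> (forall x, M < `|x| -> f x = 0) ->
  forall x, M < `|x| -> df x = 0.
Proof.
move=> h f0 x Mx.
have nb : \forall y \near x, M < `|y|.
  exact: (cvgr_gt _ (@norm_continuous R R x) _ Mx).
have h2 : is_derive x (1 : R) f 0.
  apply: (@near_eq_is_derive R R R (cst 0) f x 1 0).
  by apply: filterS nb => y My; rewrite f0.
by have [_ <-] := h x; have [_ ->] := h2.
Qed.

(** Hadamard's lemma, iterated: q_0 = h/x is even and smooth, so q_0'/(2x) is again
    even and smooth, and so on. *)
Lemma odd_profile H M : 0 <= M -> smooth_family H -> parity_family true H ->
  (forall x, M < `|x| -> H 0%N x = 0) ->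
  exists q, [/\ profile q, forall x, H 0%N x = x * q 0%N x,
    forall i x, q i (- x) = q i x & forall i x, M < `|x| -> q i x = 0].
Proof.
move=> M0 sH pH H0.
have sm i := quot_family_smooth i sH pH.
have hz i : quot_family H i 0 0 = 0.
  have := (sm i).2 0%N 0; rewrite oppr0 add0n expr1 mulN1r => h; lra.
pose q i := div_family (quot_family H i) 0.
have hq i x : quot_family H i 0 x = x * q i x.
  by rewrite mul_div_family ?hz ?subr0//; exact: (sm i).1.
have pq : profile q.
  move=> i; have [hd _] := div_family_smooth (sm i).1.
  apply: (has_deriv_eq (hd 0%N)) => x.
  by rewrite -mulrA -hq /= mulrA divff ?mul1r// pnatr_eq0.
exists q; split => //.
- exact: (hq 0%N).
- move=> i x; have := div_family_parity (sm i).2 (sm i).1 => /(_ 0%N x).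
  by rewrite addn0 expr0 mul1r.
elim=> [|i IH] x Mx.
  have x0 : x != 0 by rewrite -normr_gt0; exact: le_lt_trans Mx.
  by apply: (mulfI x0); rewrite -hq mulr0 /= H0.
have x0 : 2 * x != 0 by rewrite mulf_neq0// -normr_gt0; exact: le_lt_trans Mx.
by apply: (mulfI x0); rewrite mulr0; exact: (has_deriv_vanish (pq i) IH).
Qed.

Lemma compact_support_bound f M : continuous f -> (forall x, M < `|x| -> f x = 0) ->
  exists B, forall x, `|f x| <= B.
Proof.
move=> cf f0.
have ca : continuous (fun x => `|f x|).
  by move=> x; exact: (@continuous_comp _ _ _ f (@Num.norm R R) x (cf x) (@norm_continuous _ _ _)).
have le : - `|M| <= `|M| by rewrite ge0_cp.
have [c _ hc] := EVT_max le (continuous_subspaceT ca).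
exists `|f c| => x; have [Mx|Mx] := ltP M `|x|.
  by rewrite f0// normr0.
apply: hc; rewrite in_itv /= -ler_norml; apply: (le_trans Mx); exact: ler_norm.
Qed.

Lemma compact_support_gaussian c f M : 0 <= c -> continuous f -> (forall x, M < `|x| -> f x = 0) ->
  exists2 B, 0 <= B & forall x, `|f x| <= B * gaussian c x.
Proof.
move=> c0 cf f0; have [B hB] := compact_support_bound cf f0.
have B0 : 0 <= B by apply: le_trans (hB 0).
exists (B * expR (c * M ^+ 2)); first by rewrite mulr_ge0// expR_ge0.
move=> x; have [Mx|Mx] := ltP M `|x|.
  by rewrite f0// normr0 !mulr_ge0// expR_ge0.
apply: (le_trans (hB x)); rewrite -mulrA ler_peMr// /gaussian -expRD -expR0 ler_expR.
rewrite mulNr subr_ge0 ler_wpM2l// -(real_normK (num_real x)) -(real_normK (num_real M)).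
apply: lerXn2r; rewrite ?nnegrE//; apply: (le_trans Mx); exact: ler_norm.
Qed.

Lemma compact_support_profile_bound q M K : profile q -> (forall i x, M < `|x| -> q i x = 0) ->
  exists B, profile_bound K B q.
Proof.
move=> hq hM.
have [B hB] : {B : nat -> R | forall i, 0 <= B i /\ forall x, `|q i x| <= B i * gaussian 2 x}.
  have h i : exists B, 0 <= B /\ forall x, `|q i x| <= B * gaussian 2 x.
    have [B B0 hB] := compact_support_gaussian (ler0n R 2) (has_deriv_continuous (hq i)) (hM i).
    by exists B.
  by exists (fun i => projT1 (cid (h i))) => i; case: cid.
exists (\sum_(i < K.+1) B i) => i x iK.
apply: (le_trans ((hB i).2 x)); apply: ler_wpM2r; first exact/ltW/gaussian_gt0.
rewrite (bigD1 (Ordinal (iK : (i < K.+1)%N))) //= lerDl.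
by apply: sumr_ge0 => j _; exact: (hB j).1.
Qed.

End Division.

(** * Bernstein polynomials *)

Section Bernstein.
Context {R : realType}.
Implicit Types (g : nat -> R) (v : R).

(** The polynomial sum_j g(j) 'C(n, j) v^j (1 - v)^(n - j), that is the mean of g
    for the binomial law, defined by conditioning on the first trial: the moments
    then follow by induction without binomial coefficients. *)
Fixpoint bern n g : {poly R} :=
  if n is n'.+1 then (1 - 'X) * bern n' g + 'X * bern n' (fun j => g j.+1)
  else (g 0%N)%:P.

Lemma bernS n g v : (bern n.+1 g).[v] =
  (1 - v) * (bern n g).[v] + v * (bern n (fun j => g j.+1)).[v].
Proof. by rewrite /= !hornerE. Qed.

Lemma bern0 g v : (bern 0 g).[v] = g 0%N. Proof. exact: hornerC. Qed.

Lemma bern_le n g1 g2 v : 0 <= v <= 1 -> (forall j, (j <= n)%N -> g1 j <= g2 j) ->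
  (bern n g1).[v] <= (bern n g2).[v].
Proof.
move=> /andP[v0 v1]; elim: n g1 g2 => [|n IH] g1 g2 h.
  by rewrite !bern0; exact: h.
rewrite !bernS; apply: lerD; apply: ler_wpM2l => //; rewrite ?subr_ge0//.
  by apply: IH => j jn; apply: h; exact: leqW.
by apply: IH => j jn; exact: h.
Qed.

Lemma bern_lin n (a b : R) g1 g2 v :
  (bern n (fun j => a * g1 j + b * g2 j)).[v] = a * (bern n g1).[v] + b * (bern n g2).[v].
Proof.
elim: n g1 g2 => [|n IH] g1 g2; first by rewrite !bern0.
by rewrite !bernS !IH; ring.
Qed.

Lemma bern_cst n (a : R) v : (bern n (fun=> a)).[v] = a.
Proof. by elim: n => [|n IH]; rewrite ?bern0// bernS IH; ring. Qed.

(** The variance of the binomial law. The shift s makes the induction go through. *)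
Lemma bern_sqr n (s : R) v :
  (bern n (fun j => (j%:R + s) ^+ 2)).[v] = (n%:R * v + s) ^+ 2 + n%:R * (v * (1 - v)).
Proof.
elim: n s => [|n IH] s; first by rewrite bern0; ring.
rewrite bernS IH.
rewrite (_ : (fun j : nat => (j.+1%:R + s) ^+ 2) = (fun j : nat => (j%:R + (s + 1)) ^+ 2)).
  by rewrite IH -[n.+1%:R]natr1; ring.
by apply/funext => j; rewrite -[j.+1%:R]natr1; congr (_ ^+ 2); ring.
Qed.

(** Chebyshev's argument: for Lipschitz Q the error is at most L times the mean
    deviation |v - j/n|, bounded by d plus variance over d. *)
Lemma bernstein_approx (Q : R -> R) L : 0 <= L ->
  (forall v w, 0 <= v <= 1 -> 0 <= w <= 1 -> `|Q v - Q w| <= L * `|v - w|) ->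
  forall e, 0 < e -> exists P : {poly R}, forall v, 0 <= v <= 1 -> `|Q v - P.[v]| <= e.
Proof.
move=> L0 hQ e e0.
have L1 : 0 < 2 * L + 1 by lra.
have [d d0 dE] : exists2 d, 0 < d & d * (2 * L + 1) = e.
  by exists (e / (2 * L + 1)); rewrite ?divr_gt0// divfK// gt_eqF.
pose n := (Num.truncn (d ^- 2)).+1.
have n0 : 0 < n%:R :> R by rewrite ltr0n.
have nd : 1 <= n%:R * d ^+ 2.
  rewrite -ler_pdivrMr ?exprn_gt0// div1r; apply: ltW; exact: truncnS_gt.
exists (bern n (fun j => Q (j%:R / n%:R))) => v v01.
have [v0 v1] := andP v01.
have -> : Q v = (bern n (fun=> Q v)).[v] by rewrite bern_cst.
pose g2 (j : nat) : R := L * d * 1 + L / (d * n%:R ^+ 2) * (j%:R + - (n%:R * v)) ^+ 2.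
have B2 : (bern n g2).[v] <= e.
  rewrite /g2 bern_lin bern_cst bern_sqr subrr expr0n add0r mulr1.
  apply: (@le_trans _ _ (L * d + L * d)); last by rewrite -dE; lra.
  rewrite lerD2l.
  rewrite (_ : _ * (_ * _) = L * ((v * (1 - v)) / (d * n%:R))); last first.
    by field; rewrite !gt_eqF.
  rewrite ler_wpM2l// ler_pdivrMr ?mulr_gt0//.
  have -> : d * (d * n%:R) = n%:R * d ^+ 2 by ring.
  by apply: le_trans nd; nra.
have hj (j : nat) : (j <= n)%N -> `|Q v - Q (j%:R / n%:R)| <= g2 j.
  move=> jn; apply: (le_trans (hQ _ _ v01 _)).
    by rewrite divr_ge0//= ler_pdivrMr// mul1r ler_nat.
  set y := v - _.
  have -> : g2 j = L * (d + `|y| ^+ 2 / d).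
    by rewrite /g2 real_normK ?num_real// /y; field; rewrite !gt_eqF.
  rewrite ler_wpM2l//; move: `|y| => z.
  rewrite -(ler_pM2r d0) mulrDl divfK ?gt_eqF//.
  have := sqr_ge0 (z - d); nra.
have E (x1 x2 : nat -> R) : (bern n x1).[v] - (bern n x2).[v] = (bern n (fun j => x1 j - x2 j)).[v].
  have := bern_lin n 1 (-1) x1 x2 v; rewrite mul1r mulN1r => <-.
  by congr (_.[_]); congr bern; apply/funext => j; ring.
rewrite E ler_norml; apply/andP; split.
  rewrite lerNl; apply: le_trans B2.
  set D := fun j => _; have := bern_lin n (-1) 0 D D v; rewrite mulN1r mul0r addr0 => <-.
  apply: bern_le => // j /hj; rewrite /D mul0r addr0 mulN1r; rewrite ler_norml => /andP[? _]; lra.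
by apply: le_trans B2; apply: bern_le => // j /hj; rewrite ler_norml => /andP[_ ?].
Qed.

End Bernstein.

(** * Approximation of profiles by Gaussians *)

Section Approx.
Context {R : realType}.
Implicit Types (q p e : nat -> R -> R) (x y : R).

(** Integrating from infinity: since e_i' = 2 x e_(i+1), the function
    eps e^(-2 x^2) -+ e_i decreases on x >= 0 and vanishes at infinity. *)
Lemma profile_bound_antiderivative e K (eps : R) : profile e -> (forall i x, e i (- x) = e i x) ->
  (forall i, gauss_dominated (e i)) -> 0 <= eps -> (forall x, `|e K x| <= eps * gaussian 2 x) ->
  profile_bound K eps e.
Proof.
move=> pe ev ge eps0 hK.
have g2 := @gdom_gaussian R 2 (lexx _).
suff H d : (d <= K)%N -> forall x, `|e (K - d)%N x| <= eps * gaussian 2 x.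
  by move=> i x iK; have := H (K - i)%N (leq_subr _ _) x; rewrite subKn.
elim: d => [|d IH] dK; first by rewrite subn0.
have IH' := IH (ltnW dK); have ei : (K - d)%N = (K - d.+1).+1 by lia.
rewrite ei in IH'; move: (K - d.+1)%N IH' => i IHi.
have half (s : R) : `|s| = 1 -> forall x, 0 <= x -> s * e i x <= eps * gaussian 2 x.
  move=> s1 x x0.
  have hd := has_derivB (has_derivZ eps (@has_deriv_gaussian R 2)) (has_derivZ s (pe i)).
  rewrite -subr_ge0.
  have gD := gdomB (gdomZ eps g2) (gdomZ s (ge i)).
  have c0 : (eps * gaussian 2 (x + n%:R) - s * e i (x + n%:R)) @[n --> \oo] --> 0.
    apply: (gdom_cvg0 (u := fun n => x + n%:R) gD) => n.
    by rewrite ger0_norm ?addr_ge0// lerDr.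
  apply: (cvgr_to_le c0); apply: nearW => n.
  rewrite -lerN2.
  apply: (has_deriv_ndecr (has_derivN hd)); last by rewrite lerDl.
  move=> y /andP[xy _]; have y0 : 0 <= y by apply: le_trans x0 (ltW xy).
  have : `|s * e i.+1 y| <= eps * gaussian 2 y by rewrite normrM s1 mul1r.
  rewrite ler_norml => /andP[h _].
  have h1 : 0 <= eps * gaussian 2 y + s * e i.+1 y by lra.
  have := mulr_ge0 y0 h1; have := mulr_ge0 y0 (mulr_ge0 eps0 (ltW (gaussian_gt0 2 y))).
  by move: (gaussian 2 y) (e i.+1 y) => A B; lra.
move=> x; wlog x0 : x / 0 <= x.
  move=> H; have [/H//|/ltW x0] := leP 0 x.
  by have := H (- x); rewrite ev oppr_ge0 /gaussian sqrrN => /(_ x0).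
rewrite ler_norml; apply/andP; split.
  by have := half (-1) _ x x0; rewrite normrN1 mulN1r => /(_ erefl); rewrite lerNl.
by have := half 1 _ x x0; rewrite normr1 mul1r => /(_ erefl).
Qed.

(** As a function of v = e^(-x^2), the function q_K e^(2 x^2) is Lipschitz: compare
    its derivative in x with that of e^(-x^2). *)
Lemma profile_lipschitz q K (M : R) : profile q -> (forall i x, M < `|x| -> q i x = 0) ->
  exists2 L, 0 <= L & forall x y, 0 <= x -> x <= y ->
   `|q K x * gaussian (-2) x - q K y * gaussian (-2) y| <= L * (gauss_fun x - gauss_fun y).
Proof.
move=> hq hM.
have c1 : continuous (fun x => q K.+1 x + 2 * q K x).
  apply: continuous_add; first exact: has_deriv_continuous (hq _).
  by apply: continuous_mul; [move=> ?; exact: cvg_cst|exact: has_deriv_continuous (hq _)].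
have [] := @compact_support_gaussian R 3 _ M _ c1.
- by [].
- by move=> x Mx; rewrite !hM// mulr0 addr0.
move=> L L0 hL; exists L => // x y x0 xy.
have h1 := has_derivM (hq K) (@has_deriv_gaussian R (-2)).
have h2 := has_derivZ L (@has_deriv_gaussian R 1).
have bd z : 0 <= z -> `|2 * z * q K.+1 z * gaussian (-2) z + q K z * (- (2 * -2 * z) * gaussian (-2) z)|
    <= L * (2 * z * gaussian 1 z).
  move=> z0.
  rewrite (_ : _ + _ = (2 * z) * ((q K.+1 z + 2 * q K z) * gaussian (-2) z)); last by ring.
  have -> : L * (2 * z * gaussian 1 z) = (2 * z) * ((L * gaussian 3 z) * gaussian (-2) z).
    rewrite (_ : gaussian 1 z = gaussian 3 z * gaussian (-2) z); first by ring.
    by rewrite /gaussian -expRD; congr expR; ring.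
  rewrite normrM ger0_norm ?mulr_ge0// ler_wpM2l ?mulr_ge0//.
  by rewrite normrM (gtr0_norm (gaussian_gt0 _ _)) ler_wpM2r ?(ltW (gaussian_gt0 _ _)).
have k1 : q K x * gaussian (-2) x - L * gaussian 1 x <= q K y * gaussian (-2) y - L * gaussian 1 y.
  apply: (has_deriv_ndecr (has_derivB h1 h2)) => // z /andP[xz zy].
  have := bd z (le_trans x0 (ltW xz)); rewrite ler_norml => /andP[? _]; lra.
have k2 : - (q K x * gaussian (-2) x) - L * gaussian 1 x <= - (q K y * gaussian (-2) y) - L * gaussian 1 y.
  apply: (has_deriv_ndecr (has_derivB (has_derivN h1) h2)) => // z /andP[xz zy].
  have := bd z (le_trans x0 (ltW xz)); rewrite ler_norml => /andP[_ ?]; lra.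
by rewrite -!gaussian1 ler_norml; apply/andP; split; lra.
Qed.

Lemma gauss_fun_sqrt_ln (v : R) : 0 < v <= 1 -> gauss_fun (Num.sqrt (- ln v)) = v.
Proof.
move=> /andP[v0 v1]; rewrite /gauss_fun sqr_sqrtr ?oppr_ge0 ?ln_le0// opprK.
by rewrite lnK// posrE.
Qed.

(** A polynomial in v = e^(-x^2) times v^2 is a combination of the Gaussians
    e^(-(j + 2) x^2). *)
Lemma gaussian_approx q K (M eps : R) : profile q -> (forall i x, q i (- x) = q i x) ->
  (forall i x, M < `|x| -> q i x = 0) -> 0 < eps ->
  exists n (a : nat -> R),
    profile_bound K eps (fun i x => q i x - \sum_(j < n) a j * gaussian_profile (j%:R + 2) i x).
Proof.
move=> hq hev hM eps0.
have [L L0 hL] := profile_lipschitz K hq hM.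
pose A x := q K x * gaussian (-2) x.
pose r (v : R) := Num.sqrt (- ln v).
(* x = r v inverts v = e^(-x^2) on x >= 0, and v = 0 stands for x at infinity,
   where q_K vanishes. *)
pose Q (v : R) := if 0 < v then A (r v) else 0.
have hr (v : R) : 0 < v <= 1 -> gauss_fun (r v) = v by exact: gauss_fun_sqrt_ln.
have lip (v w : R) : 0 <= v <= 1 -> 0 <= w <= 1 -> `|Q v - Q w| <= L * `|v - w|.
  wlog vw : v w / v <= w.
    move=> H v1 w1; have [/H|/ltW /H] := leP v w; first exact.
    by rewrite distrC (distrC v); exact.
  move=> /andP[v0 v1] /andP[w0 w1].
  rewrite [`|v - w|]distrC [`|w - v|]ger0_norm ?subr_ge0// distrC /Q.
  have [v0'|v0'] := ltP 0 v.
    have w0' : 0 < w by exact: lt_le_trans vw.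
    rewrite w0' -{2}(hr v) ?v0' ?v1// -{2}(hr w) ?w0' ?w1//.
    by apply: hL; rewrite ?sqrtr_ge0// ler_wsqrtr// lerN2 ler_ln.
  have [w0'|w0'] := ltP 0 w; last first.
    by rewrite subrr normr0 mulr_ge0// subr_ge0.
  have -> : v = 0 by apply/eqP; rewrite eq_le v0 v0'.
  rewrite !subr0 -{2}(hr w) ?w0' ?w1//.
  pose y := Num.max (r w) (`|M| + 1).
  have My : M < `|y|.
    have : `|M| + 1 <= y by rewrite le_max lexx orbT.
    have := ler_norm M; have := ler_norm y; lra.
  have := hL (r w) y (sqrtr_ge0 _) (ltac:(by rewrite le_max lexx)).
  rewrite (hM K y My) mul0r subr0 => H; apply: (le_trans H); apply: ler_wpM2l => //.
  by rewrite gerBl gauss_fun_ge0.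
have [P hP] := bernstein_approx L0 lip eps0.
(* The K-th entry of the profile of a Gaussian e^(-c x^2) carries a factor (-c)^K. *)
pose a (j : nat) := P`_j / (- (j%:R + 2)) ^+ K.
exists (size P), a.
have j2 (j : nat) : 2 <= j%:R + 2 :> R by rewrite lerDr.
pose p i x := \sum_(j < size P) a j * gaussian_profile (j%:R + 2) i x.
have hp : profile p.
  move=> i; have h := has_deriv_sum (index_enum 'I_(size P))
    (fun j : 'I_(size P) => has_derivZ (a j) (@gaussian_profileP R (j%:R + 2) i)).
  apply: (has_deriv_eq h) => x; rewrite /p mulr_sumr; apply: eq_bigr => j _.
  by rewrite mulrCA.
apply: (@profile_bound_antiderivative (fun i x => q i x - p i x)); last 1 first.
- move=> x; pose v := gauss_fun x.
  have v0 : 0 < v by exact: gauss_fun_gt0.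
  have v1 : v <= 1 by exact: gauss_fun_le1.
  have rv : r v = `|x| by rewrite /r /v /gauss_fun expRK opprK sqrtr_sqr.
  have AE : A `|x| = A x.
    rewrite /A; have [//|x0] := leP 0 x; first by move=> x0; rewrite ger0_norm.
    by rewrite ltr0_norm// hev /gaussian sqrrN.
  have := hP v; rewrite ltW// v1 => /(_ erefl); rewrite /Q v0 rv AE => H.
  have -> : q K x - p K x = (A x - P.[v]) * gaussian 2 x.
    rewrite mulrBl /A -mulrA; congr (_ - _).
      by rewrite /gaussian -expRD (_ : _ + _ = 0) ?expR0 ?mulr1//; ring.
    rewrite horner_coef mulr_suml /p; apply: eq_bigr => j _.
    rewrite /a /gaussian_profile mulrA divfK; last first.
      by rewrite expf_neq0// oppr_eq0 gt_eqF// (lt_le_trans _ (j2 j)).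
    rewrite -mulrA; congr (_ * _); rewrite /v /gauss_fun -expRM_natl /gaussian -expRD.
    by congr expR; rewrite -mulr_natl; ring.
  by rewrite normrM (gtr0_norm (gaussian_gt0 _ _)) ler_wpM2r// ltW// gaussian_gt0.
- exact: profileB.
- by move=> i x; rewrite hev; congr (_ - _); apply: eq_bigr => j _; rewrite /gaussian_profile /gaussian sqrrN.
- move=> i; apply: gdomB.
    have [B B0 hB] := compact_support_gaussian (ler01 : 0 <= 1 :> R) (has_deriv_continuous (hq i)) (hM i).
    split; first exact: has_deriv_continuous (hq i).
    by exists B => x; rewrite -gaussian1.
  apply: gdom_sum => j; apply: gdomZ; apply: gdomZ; exact: gdom_gaussian.
- exact: ltW.
Qed.

End Approx.

(** * The coefficients of (- 1/x d/dx)^N (h / x) *)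

Section Bessel.
Context {R : realType}.
Implicit Types (q H : nat -> R -> R) (x : R) (N j : nat).

(** The coefficient of x^(j-2N-1) h^(j) in (- 1/x d/dx)^N (h / x), by the recursion
    obtained on differentiating once more; up to sign and order these are the
    coefficients of the Bessel polynomials. *)
Fixpoint bessel_coef N j : R :=
  if N is N'.+1 then ((2 * N').+1%:R - j%:R) * bessel_coef N' j
    - (if j is j'.+1 then bessel_coef N' j' else 0)
  else (j == 0%N)%:R.

Lemma bessel_coef_gt N j : (N < j)%N -> bessel_coef N j = 0.
Proof.
elim: N j => [|N IH] [|j] //= Nj; rewrite !IH ?mulr0 ?subr0//; exact: ltnW.
Qed.

Lemma bessel_coefE N j : (j <= N)%N ->
  bessel_coef N j = (-1) ^+ j * ((2 * N - j)`!)%:R / ((j`!)%:R * (dfact (2 * (N - j)))%:R).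
Proof.
have df0 n : (dfact n)%:R != 0 :> R.
  rewrite pnatr_eq0 -lt0n; elim/ltn_ind: n => -[|[|n]] IH //=.
  by rewrite muln_gt0 IH.
have f0 n : (n`!)%:R != 0 :> R by rewrite pnatr_eq0 -lt0n fact_gt0.
move=> jN; apply: (mulIf (_ : (j`!)%:R * (dfact (2 * (N - j)))%:R != 0)).
  by rewrite mulf_neq0.
rewrite divfK ?mulf_neq0//.
elim: N j jN => [|N IH] j jN.
  by move: jN; rewrite leqn0 => /eqP ->; rewrite /= !mulr1.
have dS n : dfact (2 * n.+1) = ((2 * n).+2 * dfact (2 * n))%N.
  by rewrite mulnS.
case: j jN => [|j] jN.
  rewrite subn0 dS [bessel_coef _ _]/= !subr0 expr0 !mul1r.
  have := IH 0%N (leq0n _); rewrite !subn0 expr0 !mul1r => E.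
  have -> : (2 * N.+1)%N = (2 * N).+2 by rewrite mulnS.
  rewrite !factS !natrM -E; ring.
rewrite subSS; rewrite ltnS in jN.
rewrite [bessel_coef _ _]/=.
have Ej := IH j jN.
have [jN'|] := ltnP j N; last first.
  move=> Nj; have {jN Nj} e : j = N by apply/eqP; rewrite eqn_leq jN.
  subst j; rewrite bessel_coef_gt// mulr0 sub0r subnn /= mulr1.
  move: Ej; rewrite subnn /= mulr1.
  have -> : (2 * N - N)%N = N by lia.
  have -> : (2 * N.+1 - N.+1)%N = N.+1 by lia.
  by rewrite factS natrM exprS mulN1r !mulNr => E; rewrite mulrCA E; ring.
have E1 := IH j.+1 jN'.
have e1 : (N - j)%N = (N - j.+1).+1 by lia.
rewrite e1 dS in Ej *.
have e2 : (2 * N - j)%N = (2 * N - j.+1).+1 by lia.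
have e3 : (2 * N.+1 - j.+1)%N = (2 * N - j.+1).+2 by lia.
rewrite e2 factS in Ej; rewrite e3 !factS.
have e4 : (2 * N).+1%:R = (2 * N - j.+1)%:R + 1 + j.+1%:R :> R.
  by rewrite natr1 -natrD; congr (_%:R); lia.
have e5 : ((2 * N - j.+1).+2)%:R = (2 * (N - j.+1)).+2%:R + j.+1%:R :> R.
  by rewrite -natrD; congr (_%:R); lia.
move: Ej E1; rewrite !factS !natrM e4 e5 exprS -[(2 * N - j.+1).+1%:R]natr1.
set d := (dfact _)%:R; set f := (j`!)%:R; set a := (2 * N - j.+1)%:R.
set F := ((2 * N - j.+1)`!)%:R; set s := (-1) ^+ j; set u := (2 * (N - j.+1)).+2%:R.
set j1 := j.+1%:R; set B1 := bessel_coef N j.+1; set B0 := bessel_coef N j.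
move=> Ej E1.
rewrite mulrBl (_ : _ * B1 * _ = (a + 1) * u * (B1 * (j1 * f * d))); last by ring.
rewrite E1 (_ : B0 * _ = j1 * (B0 * (f * (u * d)))); last by ring.
by rewrite Ej; ring.
Qed.

Lemma has_deriv_unique (f df dg : R -> R) : has_deriv f df -> has_deriv f dg -> df =1 dg.
Proof. by move=> h1 h2 x; have [_ <-] := h1 x; have [_ ->] := h2 x. Qed.

(** For h = x q_0 the operator gives (-2)^N q_N, since - 1/x d/dx sends q_i to
    - 2 q_(i+1). Multiplying by x^(2N+1) makes both sides differentiable at 0. *)
Lemma bessel_coef_sum q H N : profile q -> (forall n, has_deriv (H n) (H n.+1)) ->
  (forall x, H 0%N x = x * q 0%N x) ->
  forall x, \sum_(j < N.+1) bessel_coef N j * (x ^+ j * H j x)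
    = x ^+ (2 * N).+1 * ((-2) ^+ N * q N x).
Proof.
move=> hq hH H0; elim: N => [|N IH] x.
  by rewrite big_ord_recl big_ord0 addr0 /= expr0 expr1 !mul1r.
have D1 : has_deriv (fun x => \sum_(j < N.+1) bessel_coef N j * (x ^+ j * H j x))
    (fun x => \sum_(j < N.+1) bessel_coef N j *
       (j%:R * x ^+ j.-1 * H j x + x ^+ j * H j.+1 x)).
  by apply: has_deriv_sum => j; apply: has_derivZ; apply: has_derivM => //; exact: has_derivX.
have D2 := has_derivM (@has_derivX R (2 * N).+1) (has_derivZ ((-2) ^+ N) (hq N)).
have E : \sum_(j < N.+1) bessel_coef N j *
       (j%:R * x ^+ j.-1 * H j x + x ^+ j * H j.+1 x) =
   (2 * N).+1%:R * x ^+ (2 * N).+1.-1 * ((-2) ^+ N * q N x) +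
       x ^+ (2 * N).+1 * ((-2) ^+ N * (2 * x * q N.+1 x)).
  move: D2; under eq_fun do rewrite -IH.
  by move=> D2; exact: (has_deriv_unique D1 D2 x).
have {}E : x * (\sum_(j < N.+1) bessel_coef N j *
       (j%:R * x ^+ j.-1 * H j x + x ^+ j * H j.+1 x)) =
   (2 * N).+1%:R * (\sum_(j < N.+1) bessel_coef N j * (x ^+ j * H j x))
   - x ^+ (2 * N.+1).+1 * ((-2) ^+ N.+1 * q N.+1 x).
  rewrite E IH /= mulnS !exprS; ring.
pose t j := x ^+ j * H j x.
have -> : x ^+ (2 * N.+1).+1 * ((-2) ^+ N.+1 * q N.+1 x) =
  \sum_(j < N.+1) (((2 * N).+1%:R - j%:R) * bessel_coef N j * t j - bessel_coef N j * t j.+1).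
  have -> : x ^+ (2 * N.+1).+1 * ((-2) ^+ N.+1 * q N.+1 x) =
    (2 * N).+1%:R * (\sum_(j < N.+1) bessel_coef N j * (x ^+ j * H j x)) -
    x * (\sum_(j < N.+1) bessel_coef N j *
       (j%:R * x ^+ j.-1 * H j x + x ^+ j * H j.+1 x)) by rewrite E; ring.
  rewrite !mulr_sumr -sumrB; apply: eq_bigr => -[j /= _] _; rewrite /t.
  by case: j => [|j] /=; rewrite ?expr0 ?expr1 ?exprS; ring.
rewrite sumrB; under eq_bigr do rewrite -/(t _) /= mulrBl.
rewrite sumrB; congr (_ - _).
  by rewrite big_ord_recr /= bessel_coef_gt// mulr0 mul0r addr0.
by rewrite big_ord_recl /= mul0r add0r.
Qed.

End Bessel.

(** * The temperate extension of sigma *)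

Section Temperate.
Context {R : realType} {k : nat}.
Variables (eta xi : 'rV[R]_k).
Hypothesis heta : forall m : 'rV[int]_k, eta <> zvec R m.
Implicit Types (f g : R -> R[i]) (m : 'rV[int]_k).

Definition sigma_term f m : R[i] :=
  let r := enorm (zvec R m + eta) in
  cis (2 * pi * dotv (zvec R m) xi) / r%:C * (f r - f (- r)).

Definition sigma_ext f : R[i] := clim (box_sum (sigma_term f)).

Lemma normc_ge0 (z : R[i]) : 0 <= Normc.normc z.
Proof. by case: z => x y; exact: sqrtr_ge0. Qed.

Lemma seminorm_ub f (p n : nat) x : schwartz f ->
  `|x| ^+ p * Normc.normc (cderive n f x) <= seminorm p n f.
Proof.
by move=> [_ h]; apply: (ub_le_sup (h p n)); exists x.
Qed.

Lemma seminorm_ge0 f (p n : nat) : schwartz f -> 0 <= seminorm p n f.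
Proof.
move=> h; apply: le_trans (seminorm_ub p n 0 h).
by rewrite mulr_ge0 ?normc_ge0// exprn_ge0.
Qed.

Definition seminorm_sum f : R := \sum_(p < (2 * k).+1) \sum_(n < (2 * k).+1) seminorm p n f.

Lemma seminorm_le_sum f p : schwartz f -> (p <= 2 * k)%N -> seminorm p 0 f <= seminorm_sum f.
Proof.
move=> h pk; rewrite /seminorm_sum (bigD1 (Ordinal (pk : (p < (2 * k).+1)%N))) //=.
rewrite (bigD1 ord0) //= -addrA lerDl addr_ge0// sumr_ge0// => i _.
  exact: seminorm_ge0.
by apply: sumr_ge0 => j _; exact: seminorm_ge0.
Qed.

Lemma cderive0 f x : cderive 0 f x = f x.
Proof. by rewrite /cderive /reF /imF /=; case: (f x). Qed.

Lemma schwartz_weight f x : schwartz f ->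
  Normc.normc (f x) <= 2 ^+ k * 2 * seminorm_sum f * ((1 + x ^+ 2) ^+ k)^-1.
Proof.
move=> h; have x2 := sqr_ge0 x.
rewrite ler_pdivlMr; last by rewrite exprn_gt0// ltr_wpDr.
have n0 := normc_ge0 (f x).
apply: (@le_trans _ _ (Normc.normc (f x) * (2 ^+ k * (1 + (x ^+ 2) ^+ k)))).
  by rewrite ler_wpM2l// expr1D_le.
rewrite mulrCA -!mulrA ler_wpM2l ?exprn_ge0// mulrDr mulr1 mulr2n mulrDl mul1r.
have := seminorm_ub 0 0 x h; have := seminorm_ub (2 * k) 0 x h.
rewrite cderive0 expr0 mul1r exprM real_normK ?num_real// mulrC => h1 h2.
apply: lerD; [apply: (le_trans h2)|apply: (le_trans h1)]; exact: seminorm_le_sum.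
Qed.

Lemma sigma_term_bound : exists C : R, 0 <= C /\ forall f, schwartz f ->
  forall m, Normc.normc (sigma_term f m) <= C * seminorm_sum f * bweight eta m.
Proof.
have [d d0 hd] := enorm_gap heta.
exists (2 ^+ k * 2 * 2 / d); split; first by rewrite divr_ge0 ?(ltW d0)// !mulr_ge0// exprn_ge0.
move=> f h m; rewrite /sigma_term; have rd := hd m; set r := enorm _ in rd *.
have r0 : 0 < r by exact: lt_le_trans rd.
rewrite !Normc.normcM normc_cis mul1r Normc.normcV normc_real gtr0_norm//.
have S0 : 0 <= seminorm_sum f.
  by apply: sumr_ge0 => p _; apply: sumr_ge0 => n _; exact: seminorm_ge0.
have B0 := ltW (bweight_gt0 eta m).
have b x : x ^+ 2 = r ^+ 2 -> Normc.normc (f x) <= 2 ^+ k * 2 * seminorm_sum f * bweight eta m.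
  move=> xr; apply: (le_trans (schwartz_weight x h)); rewrite xr ler_wpM2l ?weight_bweight//.
  by rewrite !mulr_ge0// exprn_ge0.
set E := 2 ^+ k * 2 * seminorm_sum f * bweight eta m in b.
have H : Normc.normc (f r - f (- r)) <= E + E.
  by apply: (le_trans (le_normcD _ _)); rewrite normcN lerD// b// sqrrN.
have E0 : 0 <= E by rewrite !mulr_ge0// exprn_ge0.
rewrite [leRHS](_ : _ = d^-1 * (E + E)); last by rewrite /E; ring.
apply: ler_pM => //; rewrite ?invr_ge0 ?normc_ge0 ?(ltW r0)//.
by rewrite lef_pV2.
Qed.

Lemma sigma_ext_temperate : temperate sigma_ext.
Proof.
have [C [C0 hC]] := sigma_term_bound.
have cv f (h : schwartz f) := box_sum_ccvg (hC f h).
split=> [a f g sf sg|].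
  apply: clim_ccvg; have := ccvgD (ccvgMl a (cv f sf)) (cv g sg).
  congr ccvg; apply/funext => n; rewrite /box_sum mulr_sumr -big_split /=.
  apply: eq_bigr => m _; rewrite /sigma_term; ring.
exists (2 * (C * \prod_i (10 * (1 + eta 0 i ^+ 2)))), (2 * k)%N => f sf.
apply: (le_trans (ccvg_bound (cv f sf) (fun n => box_sum_norm n (hC f sf)))).
by rewrite -/(seminorm_sum f) -!mulrA [seminorm_sum f * _]mulrC.
Qed.

End Temperate.

(** * Test functions vanish at all but finitely many lattice points *)

Section Far.
Context {R : realType} {k : nat}.
Implicit Types (u : 'rV[R]_k) (m : 'rV[int]_k).

Lemma far_box u (M : R) : exists n, forall m, m \notin box n -> M < enorm (zvec R m + u).
Proof.
pose B : R := `|M| + enorm u.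
have B0 : 0 <= B by rewrite addr_ge0 ?enorm_ge0.
exists (Num.truncn B).+1 => m; rewrite mem_box => hm0.
have [i hi] : exists i, ((Num.truncn B).+1 < `|m 0%R i|)%N.
  apply/existsP; move: hm0; rewrite negb_forall.
  by under eq_existsb do rewrite -ltnNge.
apply: lt_le_trans (coord_le_enorm _ i); rewrite !mxE.
have hB : B < (Num.truncn B).+1%:R by exact: truncnS_gt.
have : ((Num.truncn B).+1%:R : R) < (absz (m 0 i))%:R by rewrite ltr_nat.
rewrite natr_absz intr_norm => hm.
have := coord_le_enorm u i; have := ler_norm M.
have := lerB_normD (m 0 i)%:~R (u 0 i).
rewrite /B in hB; lra.
Qed.

Lemma test_function_vanish (f : R -> R[i]) (M : R) u : (forall x, M < `|x| -> f x = 0) ->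
  exists n, forall m, m \notin box n -> f (enorm (zvec R m + u)) = 0 /\ f (- enorm (zvec R m + u)) = 0.
Proof.
move=> hM; have [n hn] := far_box u M; exists n => m /hn h.
by split; apply: hM; rewrite ?normrN ger0_norm ?enorm_ge0.
Qed.

Lemma sigma_ext_test (eta xi : 'rV[R]_k) (f : R -> R[i]) : test_function f ->
  sigma_ext eta xi f = sigma eta xi f.
Proof.
move=> [_ [M hM]]; have [n hn] := test_function_vanish eta hM.
have -> : sigma eta xi f = \sum_(m \in [set: 'rV[int]_k]) sigma_term eta xi f m.
  by apply: eq_fsbigr => m _; rewrite /sigma_term /delta !expr0 !mul1r !cderive0.
apply: clim_ccvg; apply: (near_ccvg (N := n)) => n' nn'.
apply: (box_sum_finite _ nn') => m /hn[h1 h2].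
by rewrite /sigma_term h1 h2 subrr mulr0.
Qed.

End Far.

(** * Odd parts of test functions and their Fourier transforms *)

Section Real.
Context {R : realType}.
Implicit Types (f g : R -> R) (x t M : R).

(** The n-th derivative of x |-> f(x) - f(-x). *)
Definition odd_family f n x : R := derive1n n f x - (-1) ^+ n * derive1n n f (- x).

Lemma derive1n_has_deriv f : (forall n x, derivable (derive1n n f) x 1) ->
  forall n, has_deriv (derive1n n f) (derive1n n.+1 f).
Proof. by move=> h n x; apply: DeriveDef => //; rewrite derive1nS derive1E. Qed.

Lemma has_deriv_opp f df : has_deriv f df -> has_deriv (fun x => f (- x)) (fun x => - df (- x)).
Proof.
move=> h; have H := has_deriv_comp h (has_derivN (@has_deriv_id R)).
by apply: (has_deriv_eq H) => x; rewrite mulN1r.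
Qed.

Lemma test_profile f M : 0 <= M -> (forall n x, derivable (derive1n n f) x 1) ->
  (forall x, M < `|x| -> f x = 0) ->
  exists q, [/\ profile q, forall x, f x - f (- x) = x * q 0%N x,
    forall i x, q i (- x) = q i x, forall i x, M < `|x| -> q i x = 0 &
    forall N x, \sum_(j < N.+1) bessel_coef N j * (x ^+ j * odd_family f j x)
      = x ^+ (2 * N).+1 * ((-2) ^+ N * q N x)].
Proof.
move=> M0 hd hM; have h := derive1n_has_deriv hd.
have hz n x : M < `|x| -> derive1n n f x = 0.
  by elim: n x => [|n IH] x; [exact: hM|exact: has_deriv_vanish (h n) IH x].
have oz n x : M < `|x| -> odd_family f n x = 0.
  by move=> Mx; rewrite /odd_family !hz ?normrN// mulr0 subr0.
have od n : has_deriv (odd_family f n) (odd_family f n.+1).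
  apply: (has_deriv_eq (has_derivB (h n) (has_derivZ ((-1) ^+ n) (has_deriv_opp (h n))))) => x.
  by rewrite /odd_family exprS; ring.
have os : smooth_family (odd_family f).
  split=> // n; exact: compact_support_bound (has_deriv_continuous (od n)) (oz n).
have op : parity_family true (odd_family f).
  move=> n x; rewrite /odd_family opprK addn1 exprS.
  have s2 : (-1) ^+ n * (-1) ^+ n = 1 :> R by rewrite -exprMn mulrNN mul1r expr1n.
  rewrite -{1}[derive1n n f (- x)]mul1r -{1}s2; ring.
have o0 x : odd_family f 0 x = f x - f (- x) by rewrite /odd_family expr0 mul1r.
have [q [hq q0 qe qM]] := odd_profile M0 os op (oz 0%N).
exists q; split => //; first by move=> x; rewrite -q0 o0.
by move=> N x; apply: bessel_coef_sum.
Qed.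

Lemma compact_gdom f M : continuous f -> (forall x, M < `|x| -> f x = 0) -> gauss_dominated f.
Proof.
move=> cf f0; have [B B0 hB] := compact_support_gaussian (ler01 : 0 <= 1 :> R) cf f0.
by split=> //; exists B => x; rewrite -gaussian1.
Qed.

Lemma sine_odd_part f t : gauss_dominated f -> gauss_dominated (fun x => f (- x)) ->
  sine_transform (fun x => f x - f (- x)) t = 2 * sine_transform f t.
Proof.
move=> gf gf'.
have E : sine_transform (fun x => f (- x)) t = - sine_transform f t.
  rewrite {2}/sine_transform -(integ_opp (gdom_sin t gf)) /sine_transform -integN; last first.
    have := gdomN (gdom_sin t gf'); congr gauss_dominated; apply/funext => x.
    by rewrite mulrN sinN mulrN.
  by congr integ; apply/funext => x; rewrite mulrN sinN mulrN opprK.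
have -> : (fun x => f x - f (- x)) = (fun x => f x + (-1) * f (- x)).
  by apply/funext => x; rewrite mulN1r.
rewrite sineD ?sineZ//; last exact: gdomZ.
by rewrite E; ring.
Qed.

End Real.

Section Fourier.
Context {R : realType}.
Implicit Types (f : R -> R[i]) (t : R).

Lemma fourier_diff f t : gauss_dominated (reF f) -> gauss_dominated (imF f) ->
  fourier f t - fourier f (- t) =
  - 'i%C * ((2 * sine_transform (reF f) (2 * pi * t))%:C + 'i%C * (2 * sine_transform (imF f) (2 * pi * t))%:C).
Proof.
move=> g1 g2.
have E s : fourier f s =
    (cosine_transform (reF f) (2 * pi * s) + sine_transform (imF f) (2 * pi * s)) +i*
    (cosine_transform (imF f) (2 * pi * s) - sine_transform (reF f) (2 * pi * s)).
  rewrite /fourier /cintegral; congr (_ +i* _).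
    rewrite -[LHS]/(integ _) /cosine_transform /sine_transform -integD; [|exact: gdom_cos|exact: gdom_sin].
    congr integ; apply/funext => x.
    rewrite {1}/reF cReM /= cosN sinN -/(reF f x) -/(imF f x); ring.
  rewrite -[LHS]/(integ _) /cosine_transform /sine_transform -integB; [|exact: gdom_cos|exact: gdom_sin].
  congr integ; apply/funext => x.
  rewrite {1}/imF cImM /= cosN sinN -/(reF f x) -/(imF f x); ring.
have cE (h : R -> R) s : cosine_transform h (- s) = cosine_transform h s.
  by congr integ; apply/funext => x; rewrite mulNr cosN.
have sE (h : R -> R) s : gauss_dominated h -> sine_transform h (- s) = - sine_transform h s.
  move=> gh; rewrite /sine_transform -integN; last exact: gdom_sin.
  by congr integ; apply/funext => x; rewrite mulNr sinN mulrN.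
rewrite !E mulrN !cE !sE//.
by apply/eqP; rewrite eq_complex /=; apply/andP; split; apply/eqP; ring.
Qed.

End Fourier.

(** * The Fourier transform of sigma *)

Section Final.
Context {R : realType} {k : nat}.
Variables (eta xi : 'rV[R]_k) (N : nat).
Hypothesis kN : k = (2 * N + 3)%N.
Hypothesis heta : forall m : 'rV[int]_k, eta <> zvec R m.
Hypothesis hxi : forall m : 'rV[int]_k, xi <> zvec R m.

Lemma summation_compact (q : nat -> R -> R) (M : R) : profile q ->
  (forall i x, q i (- x) = q i x) -> (forall i x, M < `|x| -> q i x = 0) ->
  summation_formula eta xi N q.
Proof.
move=> hq qe qM; have [B hB] := compact_support_profile_bound (2 * k) hq qM.
apply: (@summation_closure _ _ _ _ _ _ B) => //; first by lia.
move=> e e0; have [n [a ha]] := gaussian_approx (2 * k) hq qe qM e0.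
have c2 (j : nat) : 2 <= j%:R + 2 :> R by rewrite lerDr.
exists (fun i x => \sum_(j < n) a j * gaussian_profile (j%:R + 2) i x); split => //.
- move=> i; have h := has_deriv_sum (index_enum 'I_n)
    (fun j : 'I_n => has_derivZ (a j) (@gaussian_profileP R (j%:R + 2) i)).
  apply: (has_deriv_eq h) => x; rewrite mulr_sumr; apply: eq_bigr => j _.
  by rewrite mulrCA.
- apply: (@summation_lincomb R k eta xi N n a (fun j => j%:R + 2)) => // j.
  apply: summation_gaussian => // m; have [d d0 hd] := enorm_gap heta.
  exact: lt_le_trans (hd m).
Qed.

Lemma beta_coefE j : (j <= N)%N ->
  beta_coef R j k = bessel_coef N j * (1 / (2 * pi)) ^+ N.
Proof.
move=> jN; rewrite /beta_coef bessel_coefE// kN.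
have -> : (2 * N + 3 - j - 3 = 2 * N - j)%N by lia.
have -> : (2 * N + 3 - 2 * j - 3 = 2 * (N - j))%N by lia.
by have -> : ((2 * N + 3 - 3)./2 = N)%N by rewrite addnK mul2n doubleK.
Qed.

(** The inner sum of the transform, for a function with real and imaginary parts
    f1 and f2 whose odd parts have profiles q1 and q2. *)
Lemma sigma_hat_inner (f1 f2 : R -> R) (q1 q2 : nat -> R -> R) (r : R) : 0 < r ->
  (forall x, \sum_(j < N.+1) bessel_coef N j * (x ^+ j * odd_family f1 j x)
      = x ^+ (2 * N).+1 * ((-2) ^+ N * q1 N x)) ->
  (forall x, \sum_(j < N.+1) bessel_coef N j * (x ^+ j * odd_family f2 j x)
      = x ^+ (2 * N).+1 * ((-2) ^+ N * q2 N x)) ->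
  let f := fun x => f1 x +i* f2 x in
  (\sum_(j < N.+1) (beta_coef R j k * r ^+ j)%:C *
        ((-1) ^+ j * delta j r f - delta j (- r) f)) / (r ^+ (k - 2))%:C =
  ((- pi^-1) ^+ N * q1 N r)%:C + 'i%C * ((- pi^-1) ^+ N * q2 N r)%:C.
Proof.
move=> r0 h1 h2 f.
have k2 : (k - 2 = (2 * N).+1)%N by rewrite kN; lia.
have rn : r ^+ (2 * N).+1 != 0 by rewrite expf_neq0// gt_eqF.
have rnC : (r ^+ (2 * N).+1)%:C != 0 by rewrite (inj_eq (@complexI R) _ 0).
have p0 : pi != 0 :> R by rewrite gt_eqF// pi_gt0.
have cE : (1 / (2 * pi)) ^+ N * (-2) ^+ N = (- pi^-1) ^+ N :> R.
  by rewrite -exprMn; congr (_ ^+ N); move: (@pi R) p0 => P P0; field.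
rewrite k2; apply: (mulIf rnC); rewrite divfK//.
transitivity ((\sum_(j < N.+1) (beta_coef R j k * r ^+ j * odd_family f1 j r))%:C +
   'i%C * (\sum_(j < N.+1) (beta_coef R j k * r ^+ j * odd_family f2 j r))%:C).
  rewrite !rmorph_sum mulr_sumr -big_split /=; apply: eq_bigr => j _.
  have s1 : ((-1) ^+ j * (-1) ^+ j = 1 :> R[i])%R.
    by rewrite -exprMn mulrNN mul1r expr1n.
  rewrite /delta mulrA s1 mul1r.
  have -> : (-1) ^+ j * cderive j f (- r) =
     ((-1) ^+ j * derive1n j f1 (- r)) +i* ((-1) ^+ j * derive1n j f2 (- r)).
    have -> : (-1) ^+ j = ((-1) ^+ j)%:C :> R[i] by rewrite rmorphXn rmorphN1.
    by apply/eqP; rewrite eq_complex /cderive /= !mul0r subr0 addr0 !eqxx.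
  by apply/eqP; rewrite eq_complex /cderive /odd_family /=; apply/andP; split; apply/eqP; ring.
have S (g : R -> R) (q : nat -> R -> R) :
   (forall x, \sum_(j < N.+1) bessel_coef N j * (x ^+ j * odd_family g j x)
      = x ^+ (2 * N).+1 * ((-2) ^+ N * q N x)) ->
   \sum_(j < N.+1) (beta_coef R j k * r ^+ j * odd_family g j r) =
   (- pi^-1) ^+ N * q N r * r ^+ (2 * N).+1.
  move=> h; rewrite -cE -[RHS]mulrA [RHS]mulrC.
  rewrite [X in _ = X](_ : _ = (1 / (2 * pi)) ^+ N * (r ^+ (2 * N).+1 * ((-2) ^+ N * q N r))); last by ring.
  rewrite -h mulr_sumr; apply: eq_bigr => j _.
  rewrite beta_coefE; last by rewrite -ltnS.
  by rewrite mulrC; ring.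
by rewrite (S _ _ h1) (S _ _ h2) mulrDl !rcM mulrA.
Qed.

(** The summation formula is applied to the real and to the imaginary part of f. *)
Lemma sigma_ext_fourier (f : R -> R[i]) : test_function f ->
  sigma_ext eta xi (fourier f) = sigma_hat eta xi f.
Proof.
move=> [sf [M0 hM0]].
pose M := `|M0|; have M_ge0 : 0 <= M by exact: normr_ge0.
have hM x : M < `|x| -> f x = 0 by move=> h; apply: hM0; exact: le_lt_trans (ler_norm _) h.
have r1 x : M < `|x| -> reF f x = 0 by move=> h; rewrite /reF hM.
have r2 x : M < `|x| -> imF f x = 0 by move=> h; rewrite /imF hM.
have [q1 [p1 e1 ev1 v1 b1]] := test_profile M_ge0 (fun n x => (sf n x).1) r1.
have [q2 [p2 e2 ev2 v2 b2]] := test_profile M_ge0 (fun n x => (sf n x).2) r2.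
have [l1 [L1 R1]] := summation_compact p1 ev1 v1.
have [l2 [L2 R2]] := summation_compact p2 ev2 v2.
have d1 : has_deriv (reF f) _ := derive1n_has_deriv (fun n x => (sf n x).1) 0.
have d2 : has_deriv (imF f) _ := derive1n_has_deriv (fun n x => (sf n x).2) 0.
have c1 := has_deriv_continuous d1; have c2 := has_deriv_continuous d2.
have oc1 := has_deriv_continuous (has_deriv_opp d1).
have oc2 := has_deriv_continuous (has_deriv_opp d2).
have g1 := compact_gdom c1 r1; have g2 := compact_gdom c2 r2.
have g1' : gauss_dominated (fun x => reF f (- x)).
  by apply: (compact_gdom (M := M) oc1) => x h; apply: r1; rewrite normrN.
have g2' : gauss_dominated (fun x => imF f (- x)).
  by apply: (compact_gdom (M := M) oc2) => x h; apply: r2; rewrite normrN.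
have F1 : sigma_ext eta xi (fourier f) = - 'i%C * (l1 + 'i%C * l2).
  apply: clim_ccvg; have := ccvgMl (- 'i%C) (ccvgD L1 (ccvgMl 'i%C L2)).
  congr ccvg; apply/funext => n; rewrite /box_sum mulr_sumr -big_split /= mulr_sumr.
  apply: eq_bigr => m _; rewrite /sigma_term /lhs_term fourier_diff//.
  rewrite -!sine_odd_part//.
  have -> : (fun x => x * q1 0%N x) = (fun x => reF f x - reF f (- x)).
    by apply/funext => x; rewrite e1.
  have -> : (fun x => x * q2 0%N x) = (fun x => imF f x - imF f (- x)).
    by apply/funext => x; rewrite e2.
  rewrite !rcM !fmorphV /=; ring.
rewrite F1 /sigma_hat -mulrA; congr (_ * _).
have -> : ((k - 3)./2 = N)%N by rewrite kN addnK mul2n doubleK.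
set w := cis _.
pose term (m : 'rV[int]_k) : R[i] :=
  let r := enorm (zvec R m + xi) in
  cis (- (2 * pi * dotv (zvec R m) eta)) *
    (((- pi^-1) ^+ N * q1 N r)%:C + 'i%C * ((- pi^-1) ^+ N * q2 N r)%:C).
have [d d0 hd] := enorm_gap hxi.
transitivity (w * \sum_(m \in [set: 'rV[int]_k]) term m); last first.
  congr (_ * _); apply: eq_fsbigr => m _; rewrite /term.
  have r0 := lt_le_trans d0 (hd m).
  have <- := sigma_hat_inner r0 (b1 N) (b2 N).
  have -> : (fun x => reF f x +i* imF f x) = f.
    by apply/funext => x; rewrite /reF /imF; case: (f x).
  by rewrite mulrA [RHS]mulrAC.
have [n hn] := far_box xi M.
have H1 := ccvgD R1 (ccvgMl 'i%C R2).
apply: (ccvg_unique H1); apply: (near_ccvg (N := n)) => n' nn'.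
rewrite -(box_sum_finite (N := n) _ nn'); last first.
  move=> m /hn h; have h' : M < `|enorm (zvec R m + xi)| by rewrite ger0_norm ?enorm_ge0.
  by rewrite /term v1// v2// !mulr0 addr0 mulr0.
rewrite /box_sum !mulr_sumr -big_split /=; apply: eq_bigr => m _.
by rewrite /rhs_term /term -/w; ring.
Qed.

End Final.

Theorem corollary2p4 (R : realType) (k : nat) (eta xi : 'rV[R]_k)
    (hk3 : (3 <= k)%N) (hkodd : odd k)
    (heta : forall m : 'rV[int]_k, eta <> zvec R m)
    (hxi : forall m : 'rV[int]_k, xi <> zvec R m) :
  has_fourier_transform (sigma eta xi) (sigma_hat eta xi).
Proof.
have kN : k = (2 * ((k - 3)./2) + 3)%N.
  have := odd_double_half (k - 3); rewrite oddB// hkodd /= add0n -mul2n => ->.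
  by rewrite subnK.
exists (sigma_ext eta xi); split.
- exact: sigma_ext_temperate.
- exact: sigma_ext_test.
- exact: (sigma_ext_fourier kN).
Qed.
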